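(* Let $\mu_4$ and $\mu_{16}$ be the standard one-fourth and one-sixteenth Cantor measures with digit set $\{0,1\}$, and let $\lambda_{16}$ be the equal-weight self-similar probability measure on $\mathbb{R}$ generated by the maps $x\mapsto\frac1{16}x$ and $x\mapsto\frac1{16}(x+4)$. Then the supports $K_{\mu_{16}}$ and $K_{\lambda_{16}}$ form a packing pair, i.e. $(K_{\mu_{16}}-K_{\mu_{16}})\cap(K_{\lambda_{16}}-K_{\lambda_{16}})=\{0\}$, and for every $x\in\mathbb{R}$ the measure $\mu_4+\delta_x\ast\mu_{16}$ is translationally singular and does not admit any frame measure.
   Context: $\mu_4,\mu_{16}$ are the unique Borel probability measures on $\mathbb{R}$ with $\mu_4(E)=\frac12\mu_4(4E)+\frac12\mu_4(4E-1)$, $\mu_{16}(E)=\frac12\mu_{16}(16E)+\frac12\mu_{16}(16E-1)$; $\lambda_{16}$ is the unique Borel probability measure with $\lambda_{16}(E)=\frac12\lambda_{16}(16E)+\frac12\lambda_{16}(16E-4)$. $K_\rho$ denotes the closed support of a finite Borel measure $\rho$ (smallest closed set of full measure). $\delta_x\ast\rho(E)=\rho(E-x)$. Frame measure: a locally finite Borel measure $\Gamma$ on $\mathbb{R}^d$ is a frame measure for a finite Borel measure $\rho$ on $\mathbb{R}^d$ if there are $0<A\le B<\infty$ with $A\|f\|_{L^2(\rho)}^2\le\int|(f\,d\rho)^{\widehat{}}(\xi)|^2d\Gamma(\xi)\le B\|f\|_{L^2(\rho)}^2$ for all $f\in L^2(\rho)$, where $(f\,d\rho)^{\widehat{}}(\xi)=\int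 f(x)e^{-2\pi i\langle\xi,x\rangle}d\rho(x)$. Translational absolute continuity: a Borel set $X$ is a Borel support of $\rho$ if $X\subset K_\rho$ and $\rho(X)=\rho(K_\rho)$. For a Borel set $E\subset K_\rho$ with $\rho(E)>0$, $\rho$ is translationally absolutely continuous on $E$ if for every $t$ the measure $\omega_t(F):=\rho((F+t)\cap(E+t))$ is absolutely continuous with respect to $\rho$. $\rho$ is translationally absolutely continuous if there is a Borel support $X$ of $\rho$ such that $\rho$ is translationally absolutely continuous on every Borel set $E\subset X$ with $\rho(E)>0$; otherwise $\rho$ is translationally singular. *)

(* Defs.v *)
From HB Require Import structures.
From mathcomp Require Import all_boot all_order all_algebra.
From mathcomp Require Import complex.
From mathcomp Require Import all_classical all_reals all_analysis measurable_realfun.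
Set Implicit Arguments.
Unset Strict Implicit.
Unset Printing Implicit Defensive.
Import Order.TTheory GRing.Theory Num.Theory.
Import numFieldNormedType.Exports.
Local Open Scope classical_set_scope.
Local Open Scope ring_scope.

(** Borel measures on the line are measures on [R] for the canonical
    [measurableType] structure of a [realType]. *)

(** [N E - d] is the set of all [N x - d] with [x] in [E]; the maps of the
    iterated function system are [x |-> x / N] and [x |-> (x + d) / N]. *)
Definition self_similar (R : realType) (N d : R)
    (mu : probability R R) : Prop :=
  forall E : set R, measurable E ->
    mu E = ((2^-1)%:E * mu [set (N * x)%R | x in E]
            + (2^-1)%:E * mu [set (N * x - d)%R | x in E])%E.

(** This intersection is itself of full measure, the line being second
    countable, so it is the smallest closed set of full measure. *)
Definition closed_support (R : realType)
    (rho : {finite_measure set R -> \bar R}) : set R :=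
  \bigcap_(C in [set C : set R | closed C /\ rho C = rho setT]) C.

Definition packing_pair (R : realType) (K L : set R) : Prop :=
  [set x - y | x in K & y in K] `&` [set x - y | x in L & y in L] = [set 0].

(** The preimage of [E] is [E - x], so this is [E |-> rho (E - x)], the
    convolution of [rho] with the Dirac mass at [x]. *)
Definition translate_measure (R : realType) (x : R)
    (rho : {finite_measure set R -> \bar R}) : set R -> \bar R :=
  pushforward rho (fun y : R => y + x : R).

Section translate_measure.
Context (R : realType) (x : R) (rho : {finite_measure set R -> \bar R}).

Let measurable_translation : measurable_fun setT (fun y : R => y + x : R).
Proof. by apply: continuous_measurable_fun => y; apply: cvgD; [exact: cvg_id|exact: cvg_cst]. Qed.

HB.instance Definition _ := Measure.copy (translate_measure x rho)
  (measure_function_pushforward__canonical__measure_function_Measure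
     rho measurable_translation).

Let translate_measure_fin : fin_num_fun (translate_measure x rho).
Proof.
move=> U mU; rewrite /translate_measure /pushforward.
apply: fin_num_measure; rewrite -[X in measurable X]setTI.
exact: measurable_translation.
Qed.

HB.instance Definition _ :=
  @Measure_isFinite.Build _ _ _ (translate_measure x rho) translate_measure_fin.
End translate_measure.

Section sum_measure.
Context (R : realType) (rho sigma : {finite_measure set R -> \bar R}).

Let measure_add_fin : fin_num_fun (measure_add rho sigma).
Proof.
by move=> U mU; rewrite measure_addE fin_numD !fin_num_measure.
Qed.

Definition sum_measure : set R -> \bar R := measure_add rho sigma.

HB.instance Definition _ := Measure.on sum_measure.

HB.instance Definition _ :=
  @Measure_isFinite.Build _ _ _ sum_measure measure_add_fin.
End sum_measure.

(** [R[i]] carries no measurable structure, so measurability and integration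
    of complex functions go through real and imaginary parts. *)
Definition cmeasurable (R : realType) (f : R -> R[i]) : Prop :=
  measurable_fun setT (fun x => complex.Re (f x)) /\
  measurable_fun setT (fun x => complex.Im (f x)).

Definition cintegral (R : realType) (rho : {finite_measure set R -> \bar R})
    (f : R -> R[i]) : R[i] :=
  Complex (\int[rho]_(x in setT) complex.Re (f x))
          (\int[rho]_(x in setT) complex.Im (f x)).

Definition normL2_sq (R : realType) (rho : {finite_measure set R -> \bar R})
    (f : R -> R[i]) : \bar R :=
  (\int[rho]_x ((Normc.normc (f x)) ^+ 2)%:E)%E.

Definition inL2 (R : realType) (rho : {finite_measure set R -> \bar R})
    (f : R -> R[i]) : Prop :=
  cmeasurable f /\ (normL2_sq rho f < +oo)%E.

Definition expi (R : realType) (t : R) : R[i] := Complex (cos t) (sin t).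

Definition fourier (R : realType) (rho : {finite_measure set R -> \bar R})
    (f : R -> R[i]) (xi : R) : R[i] :=
  cintegral rho (fun x => f x * expi (- (2 * pi * (xi * x)))).

Definition locally_finite (R : realType)
    (Gamma : {measure set R -> \bar R}) : Prop :=
  forall x : R, exists U : set R, [/\ open U, U x & (Gamma U < +oo)%E].

Definition frame_measure (R : realType)
    (rho : {finite_measure set R -> \bar R})
    (Gamma : {measure set R -> \bar R}) : Prop :=
  locally_finite Gamma /\
  exists A B : R, [/\ 0 < A, A <= B & forall f : R -> R[i], inL2 rho f ->
    (A%:E * normL2_sq rho f
       <= \int[Gamma]_xi ((Normc.normc (fourier rho f xi)) ^+ 2)%:E)%E /\
    (\int[Gamma]_xi ((Normc.normc (fourier rho f xi)) ^+ 2)%:E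
       <= B%:E * normL2_sq rho f)%E].

Definition borel_support (R : realType)
    (rho : {finite_measure set R -> \bar R}) (X : set R) : Prop :=
  [/\ measurable X, X `<=` closed_support rho
    & rho X = rho (closed_support rho)].

Definition translationally_ac_on (R : realType)
    (rho : {finite_measure set R -> \bar R}) (E : set R) : Prop :=
  forall t : R,
    (fun F : set R => rho ([set y + t | y in F] `&` [set y + t | y in E]))
      `<< rho.

Definition translationally_ac (R : realType)
    (rho : {finite_measure set R -> \bar R}) : Prop :=
  exists X : set R, borel_support rho X /\
    forall E : set R, measurable E -> E `<=` X -> (0 < rho E)%E ->
      translationally_ac_on rho E.

Definition translationally_singular (R : realType)
    (rho : {finite_measure set R -> \bar R}) : Prop :=
  ~ translationally_ac rho.

(* Main.v *)
(** Write [K], [L] for the Cantor sets carrying [mu16] and [lam16], and [rho] for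
    [mu4 + delta_a * mu16]. Base 4 digits of even and odd rank give
    [mu4 = mu16 * lam16], carried by the direct sum [K + L]. Since [a + K] is
    [mu4]-null, functions on [a + K] and on its complement test the two summands of
    [rho] separately.

    Frame measures. Let [g_n] be the indicator of the part of [K + L] whose
    [L]-component has its first [n] digits equal to 0. Then
    [|(g_n d mu4)^| <= C 2^-n |mu16^|] pointwise, [mu16^] having the same modulus as
    the transform of [delta_a * mu16], while [||g_n||^2 = 2^-n]. A frame measure with
    bounds [A], [B] would give [A 2^-n <= C^2 4^-n B] for all [n].

    Translational singularity. The sets [K + s], [s] in [L], are disjoint, so
    [mu16 (K + s - a) = 0] for [lam16]-almost every [s]. For a Borel support [X] and
    such [s], the part of [K + s] lying in [X] and coming from [X] by the translation
    [s - a] is [rho]-null; translating it back, absolute continuity on [X] forces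
    [mu16 (X - s) = 0]. Integrating in [s] gives [mu4 X = 0]. *)

Require Import Defs.
From mathcomp Require Import all_boot all_order all_algebra.
From mathcomp Require Import complex.
From mathcomp Require Import all_classical all_reals all_analysis.
From mathcomp Require Import measurable_realfun.
From mathcomp Require Import ring lra.
Set Implicit Arguments.
Unset Strict Implicit.
Unset Printing Implicit Defensive.
Import Order.TTheory GRing.Theory Num.Theory.
Import numFieldNormedType.Exports.
Local Open Scope classical_set_scope.
Local Open Scope ring_scope.

(** * Geometric bounds and real-valued probabilities *)

Lemma exists_expr2V_lt (R : realType) (e : R) : 0 < e -> exists n, 2^-1 ^+ n < e.
Proof.
move=> e0; exists (Num.bound e^-1); rewrite exprVn invf_plt ?posrE ?exprn_gt0//.
apply: lt_le_trans (archi_boundP _) _; first by rewrite invr_ge0 ltW.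
by rewrite -natrX ler_nat ltnW// ltn_expl.
Qed.

(** Replaces passages to the limit: nullity and equality are reduced below to an error that at least
    halves with each digit. *)
Lemma le0_expr2V (R : realType) (a C : R) :
  (forall n, a <= C * 2^-1 ^+ n) -> a <= 0.
Proof.
move=> aC; rewrite leNgt; apply/negP => a0.
have C0 : 0 < C by have := aC 0%N; rewrite expr0 mulr1; exact: lt_le_trans.
have [n] := @exists_expr2V_lt _ (a / C) (divr_gt0 a0 C0).
by rewrite ltr_pdivlMr// mulrC ltNge aC.
Qed.

Section real_probability.
Context {R : realType}.
Implicit Types (P : probability R R) (A B : set R).

(** Masses are read in [R] so that linear arithmetic applies to them. *)
Definition pr P A : R := fine (P A).

Lemma prE P A : measurable A -> P A = (pr P A)%:E.
Proof. by move=> mA; rewrite /pr fineK// fin_num_measure. Qed.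

Lemma pr_ge0 P A : 0 <= pr P A.
Proof. by rewrite fine_ge0. Qed.

Lemma pr_le1 P A : measurable A -> pr P A <= 1.
Proof. by move=> mA; rewrite -lee_fin -prE// probability_le1. Qed.

Lemma le_pr P A B : measurable A -> measurable B -> A `<=` B -> pr P A <= pr P B.
Proof. by move=> mA mB AB; rewrite -lee_fin -!prE// le_measure ?inE. Qed.

Lemma prU P A B : measurable A -> measurable B ->
  pr P (A `|` B) <= pr P A + pr P B.
Proof.
move=> mA mB; rewrite -lee_fin EFinD -!prE//; last exact: measurableU.
exact: measureU2.
Qed.

Lemma prT P : pr P setT = 1.
Proof. by rewrite /pr probability_setT. Qed.

Lemma prC P A : measurable A -> pr P (~` A) = 1 - pr P A.
Proof.
move=> mA; apply: EFin_inj; rewrite -prE; last exact: measurableC.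
by rewrite probability_setC// EFinB -prE.
Qed.

Lemma pr_eq0 P A : pr P A = 0 -> measurable A -> P A = 0%E.
Proof. by move=> A0 mA; rewrite prE// A0. Qed.

Lemma pr_full P A B : measurable A -> measurable B -> pr P A = 1 ->
  A `&` B = set0 -> pr P B = 0.
Proof.
move=> mA mB A1 AB; apply/eqP; rewrite eq_le pr_ge0 andbT.
have -> : 0 = pr P (~` A) by rewrite prC// A1 subrr.
by apply: le_pr => //; [exact: measurableC|apply/disjoints_subset; rewrite setIC].
Qed.

Lemma pr_bigcap P (F : (set R)^nat) : (forall n, measurable (F n)) ->
  (forall n, pr P (F n) = 1) -> pr P (\bigcap_n F n) = 1.
Proof.
move=> mF F1; have mI : measurable (\bigcap_n F n) by exact: bigcapT_measurable.
suff : pr P (~` \bigcap_n F n) = 0 by rewrite prC//; lra.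
rewrite /pr measure_negligible//; first exact: measurableC.
rewrite setC_bigcap; apply: negligible_bigcup => n.
apply/negligibleP; first exact: measurableC.
by apply: pr_eq0; [rewrite prC// F1 subrr|exact: measurableC].
Qed.

Lemma pr_setI P A B : measurable A -> measurable B -> pr P B = 1 ->
  pr P (A `&` B) = pr P A.
Proof.
move=> mA mB B1; apply/eqP; rewrite eq_le le_pr//=; last exact: measurableI.
have : pr P A <= pr P ((A `&` B) `|` ~` B).
  apply: le_pr => //.
    by apply: measurableU; [exact: measurableI|exact: measurableC].
  by move=> x Ax; have [Bx|Bx] := pselect (B x); [left|right].
move=> /le_trans; apply; apply: le_trans (prU _ _ _) _.
- exact: measurableI.
- exact: measurableC.
- by rewrite prC// B1 subrr addr0.
Qed.
End real_probability.

Section affine.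
Context {R : realType}.

Lemma continuous_affine (a b : R) : continuous (fun x : R => a * x + b).
Proof.
by move=> x; apply: cvgD; [apply: cvgM; [exact: cvg_cst|exact: cvg_id]|exact: cvg_cst].
Qed.

Lemma measurable_affine (a b : R) : measurable_fun setT (fun x : R => a * x + b).
Proof. by apply: continuous_measurable_fun; exact: continuous_affine. Qed.

Lemma measurable_preaffine (a b : R) (E : set R) :
  measurable E -> measurable [set x | E (a * x + b)].
Proof.
by move=> mE; rewrite -[X in measurable X]setTI; exact: measurable_affine.
Qed.

End affine.

(** * Self-similar measures and their Cantor supports *)

(** The fixed point of [x |-> (x + d) / N], hence the right end of the convex hull of the Cantor
    set; the left end is [0]. *)
Definition hull {R : realType} (N d : R) : R := d / (N - 1).

(** Levels are pulled back along the expanding maps, so closedness follows by continuity and each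
    step reads off one digit. *)
Fixpoint cantor_level {R : realType} (N d : R) (n : nat) : set R :=
  if n is m.+1 then
    [set x | cantor_level N d m (N * x) \/ cantor_level N d m (N * x - d)]
  else `[0, hull N d]%classic.

Definition cantor {R : realType} (N d : R) : set R :=
  \bigcap_n cantor_level N d n.

Section cantor.
Context {R : realType} {N d : R}.
Hypothesis N4 : 4 <= N.
Hypothesis d0 : 0 < d.

Let N0 : 0 < N. Proof. by apply: lt_le_trans N4. Qed.

Lemma hullE : N * hull N d = hull N d + d.
Proof.
by rewrite /hull; field; rewrite subr_eq0 gt_eqF//; apply: lt_le_trans N4; rewrite ltr1n.
Qed.

Lemma hull_gt0 : 0 < hull N d.
Proof. by rewrite divr_gt0// subr_gt0; apply: lt_le_trans N4; rewrite ltr1n. Qed.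

Lemma hull_le : 3 * hull N d <= d.
Proof.
have N41 := N4; have HE := hullE; have H0 := hull_gt0.
have : 4 * hull N d <= N * hull N d by rewrite ler_pM2r.
lra.
Qed.

Lemma cantor_level_hull n : cantor_level N d n `<=` `[0, hull N d].
Proof.
have HE := hullE; have H0 := hull_gt0; have d_gt0 := d0.
elim: n => [//|n IH] x /= [] /IH; rewrite /= !in_itv/= => /andP[h1 h2];
  apply/andP; split; rewrite -(ler_pM2l N0); lra.
Qed.

Lemma closed_cantor_level n : closed (cantor_level N d n).
Proof.
elim: n => [|n IH]; first exact: itv_closed.
have cl b : closed [set x | cantor_level N d n (N * x + b)].
  by apply: closed_comp IH => x _; exact: continuous_affine.
have := closedU (cl 0) (cl (- d)).
by congr closed; apply/seteqP; split => x /=; rewrite addr0.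
Qed.

Lemma closed_cantor : closed (cantor N d).
Proof. by apply: closed_bigI => n _; exact: closed_cantor_level. Qed.

Lemma measurable_cantor_level n : measurable (cantor_level N d n).
Proof. by apply: closed_measurable; exact: closed_cantor_level. Qed.

Lemma measurable_cantor : measurable (cantor N d).
Proof. by apply: closed_measurable; exact: closed_cantor. Qed.

End cantor.

Section self_similar.
Context {R : realType} {N d : R} {P : probability R R}.
Hypothesis N4 : 4 <= N.
Hypothesis d0 : 0 < d.
Hypothesis ssP : self_similar N d P.

Let N0 : 0 < N. Proof. by apply: lt_le_trans N4. Qed.

Let mulVK x : N * (N^-1 * x) = x. Proof. by rewrite mulVKf// gt_eqF. Qed.

(** The images in [self_similar] become preimages under the contractions, measurable by continuity;
    the [+ 0] gives both branches the same affine shape. *)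
Lemma self_similarE (E : set R) : measurable E ->
  2 * pr P E = pr P [set x | E (N^-1 * x + 0)] + pr P [set x | E (N^-1 * x + N^-1 * d)].
Proof.
move=> mE; have /(congr1 fine) := ssP mE.
have -> : [set (N * x)%R | x in E] = [set x | E (N^-1 * x + 0)].
  apply/seteqP; split => [_ [x Ex <-]|x Ex] /=.
    by rewrite addr0 mulKf// gt_eqF.
  by exists (N^-1 * x + 0) => //; rewrite addr0.
have -> : [set (N * x - d)%R | x in E] = [set x | E (N^-1 * x + N^-1 * d)].
  apply/seteqP; split => [_ [x Ex <-]|x Ex] /=.
    by rewrite -mulrDr subrK mulKf// gt_eqF.
  by exists (N^-1 * x + N^-1 * d) => //; rewrite -mulrDr mulVK addrK.
rewrite !(prE P) //; [|exact: measurable_preaffine..].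
by rewrite /= /pr -mulrDr => ->; lra.
Qed.

Let expr2_le n : 2 ^+ n <= N ^+ n.
Proof. by rewrite lerXn2r ?nnegrE ?ler0n ?(ltW N0)// (le_trans _ N4)// ler_nat. Qed.

Lemma exists_expr_ge (r x : R) : 0 < r -> exists n, x <= N ^+ n * r.
Proof.
move=> r0; have [x0|x0] := leP x 0.
  by exists 0%N; apply: le_trans x0 _; rewrite expr0 mul1r ltW.
have [n + ] := exists_expr2V_lt (divr_gt0 r0 x0).
rewrite exprVn ltr_pdivlMr// mulrC ltr_pdivrMr ?exprn_gt0// => /ltW xn.
by exists n; apply: le_trans xn _; rewrite mulrC ler_pM2r//; exact: expr2_le.
Qed.

(** Both contractions map the [N s]-neighbourhood of the hull into its [s]-neighbourhood, so
    shrinking the radius by [N] loses no mass. *)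
Let self_similar_expand (n : nat) (r : R) : 0 < r ->
  pr P `[- (N ^+ n * r), hull N d + N ^+ n * r] <= pr P `[- r, hull N d + r].
Proof.
move=> r0; elim: n => [|n IH]; first by rewrite expr0 mul1r.
apply: le_trans IH; set s := N ^+ n * r.
have s0 : 0 < s by rewrite mulr_gt0// exprn_gt0.
have -> : N ^+ n.+1 * r = N * s by rewrite exprS mulrA.
have mI (a b : R) : measurable (`[a, b]%classic : set R) by [].
have := self_similarE (mI (- s) (hull N d + s)).
set A := pr P `[- (N * s), hull N d + N * s].
have HE := @hullE _ _ d N4; have H0 := hull_gt0 N4 d0; have d_gt0 := d0.
suff : A <= pr P [set x | `[- s, hull N d + s]%classic (N^-1 * x + 0)] /\
       A <= pr P [set x | `[- s, hull N d + s]%classic (N^-1 * x + N^-1 * d)] by lra.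
split; apply: le_pr => //; try exact: measurable_preaffine.
- move=> x /=; rewrite !in_itv/= addr0 => /andP[h1 h2]; apply/andP; split.
    by rewrite -(ler_pM2l N0) mulVK; lra.
  by rewrite -(ler_pM2l N0) mulVK mulrDr; lra.
- move=> x /=; rewrite !in_itv/= => /andP[h1 h2]; apply/andP; split.
    by rewrite -(ler_pM2l N0) mulrDr !mulVK; lra.
  by rewrite -(ler_pM2l N0) !mulrDr !mulVK; lra.
Qed.

Let self_similar_thick_hull (r : R) : 0 < r -> pr P `[- r, hull N d + r] = 1.
Proof.
move=> r0; apply/eqP; rewrite eq_le pr_le1//=.
(* The mass of [[-n, n]] tends to 1, and each such interval lies in some neighbourhood of the hull
   of radius [N ^ m r], whose mass is at most that of radius [r]. *)
pose F (n : nat) : set R := `[- n%:R, n%:R]%classic.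
have FT : \bigcup_n F n = setT.
  apply/seteqP; split => // x _; exists (Num.bound `|x|) => //=.
  by rewrite /F/= in_itv/= -ler_norml ltW// archi_boundP.
have := @nondecreasing_cvg_mu _ _ _ P F.
rewrite FT => /(_ (fun=> measurable_itv _) measurableT) cF.
have {}cF := cF _; rewrite -lee_fin -prE// -(@probability_setT _ _ _ P).
have ndF : nondecreasing_seq F.
  move=> m n mn; apply/subsetPset => x; rewrite /F/= !in_itv/= => /andP[h1 h2].
  by have : m%:R <= n%:R :> R; [rewrite ler_nat|move=> ?; apply/andP; split; lra].
rewrite -(cvg_lim _ (cF ndF))//; apply: lime_le; first by apply/cvg_ex; eexists; exact: cF.
apply: nearW => n /=.
have [m nm] := exists_expr_ge n%:R r0.
have mF : measurable (F n) by exact: measurable_itv.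
rewrite !prE// lee_fin; apply: le_trans (self_similar_expand m r0).
apply: le_pr => // x; rewrite /F/= !in_itv/= => /andP[h1 h2].
by have H0 := hull_gt0 N4 d0; apply/andP; split; lra.
Qed.

Lemma self_similar_hull : pr P `[0, hull N d] = 1.
Proof.
have -> : `[0, hull N d]%classic =
    \bigcap_n `[- 2^-1 ^+ n, hull N d + 2^-1 ^+ n]%classic :> set R.
  apply/seteqP; split => [x /= + n _|x xI] /=; rewrite !in_itv/=.
    move=> /andP[h1 h2]; have : 0 < 2^-1 ^+ n :> R by rewrite exprn_gt0.
    by move=> ?; apply/andP; split; lra.
  apply/andP; split.
    rewrite -oppr_le0; apply: (@le0_expr2V _ _ 1) => n; rewrite mul1r.
    by have := xI n I; rewrite /= in_itv/= => /andP[+ _]; lra.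
  rewrite -subr_le0; apply: (@le0_expr2V _ _ 1) => n; rewrite mul1r.
  by have := xI n I; rewrite /= in_itv/= => /andP[_ +]; lra.
by apply: pr_bigcap => // n; apply: self_similar_thick_hull; rewrite exprn_gt0.
Qed.

(* The two branches of an interval shorter than the gap [d - hull N d >= 2 d / 3]
   cannot both meet the hull, so each scaling by [N] halves the mass. *)
Lemma self_similar_itv_le (m : nat) (a b : R) :
  b - a <= d / 2 * N^-1 ^+ m -> pr P `[a, b] <= 2^-1 ^+ m.
Proof.
elim: m a b => [|m IH] a b; first by rewrite expr0 pr_le1.
move=> ab; have mI : measurable (`[a, b]%classic : set R) by [].
have := self_similarE mI.
have -> : [set x | `[a, b]%classic (N^-1 * x + 0)] = `[N * a, N * b]%classic.
  by apply/seteqP; split => x /=; rewrite !in_itv/= addr0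
    -[_ <= N^-1 * x](ler_pM2l N0) -[N^-1 * x <= _](ler_pM2l N0) mulVK.
have -> : [set x | `[a, b]%classic (N^-1 * x + N^-1 * d)] = `[N * a - d, N * b - d]%classic.
  by apply/seteqP; split => x /=; rewrite !in_itv/=
    -[_ <= N^-1 * x + _](ler_pM2l N0) -[N^-1 * x + _ <= _](ler_pM2l N0) mulrDr !mulVK
    lerBlDr lerBrDr.
have {}ab : N * b - N * a <= d / 2 * N^-1 ^+ m.
  rewrite -mulrBr; apply: le_trans (_ : N * (d / 2 * N^-1 ^+ m.+1) <= _).
    by rewrite ler_pM2l.
  by rewrite exprS mulrCA mulVK.
have d_gt0 := d0; have H3 := hull_le N4 d0; have H0 := hull_gt0 N4 d0.
have Nm : d / 2 * N^-1 ^+ m <= d / 2.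
  rewrite ler_piMr//; first by lra.
  rewrite exprVn invf_le1 ?exprn_gt0// exprn_ege1//.
  by rewrite (le_trans _ N4)// ler1n.
have h1 := IH (N * a) (N * b) ab.
have h2 : pr P `[N * a - d, N * b - d] <= 2^-1 ^+ m by apply: IH; lra.
have [Nbd|Nbd] := ltP (N * b) d.
  have -> : pr P `[N * a - d, N * b - d] = 0.
    apply: (pr_full _ _ self_similar_hull) => //; rewrite -subset0 => x /=.
    by rewrite !in_itv/= => -[/andP[? _] /andP[_ ?]]; lra.
  by rewrite exprS; lra.
have -> : pr P `[N * a, N * b] = 0.
  apply: (pr_full _ _ self_similar_hull) => //; rewrite -subset0 => x /=.
  by rewrite !in_itv/= => -[/andP[_ ?] /andP[? _]]; lra.
by rewrite exprS; lra.
Qed.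

Lemma self_similar_set1 (a : R) : pr P [set a] = 0.
Proof.
apply/eqP; rewrite eq_le pr_ge0 andbT; apply: (@le0_expr2V _ _ 1) => n.
rewrite mul1r -set_itv1; apply: self_similar_itv_le.
by rewrite subrr mulr_ge0// ?divr_ge0 ?exprn_ge0 ?invr_ge0// ltW.
Qed.

(** The branch fixing [0] alone gives a symmetric interval at least half the mass of its [N]-fold
    enlargement, and finitely many enlargements cover the hull. *)
Lemma self_similar_itv0_gt0 (e : R) : 0 < e -> 0 < pr P `[- e, e].
Proof.
move=> e0; have [n hn] := exists_expr_ge (hull N d) e0.
suff : 2^-1 ^+ n * pr P `[- (N ^+ n * e), N ^+ n * e] <= pr P `[- e, e].
  apply: lt_le_trans; rewrite mulr_gt0 ?exprn_gt0//.
  apply: (@lt_le_trans _ _ (pr P `[0, hull N d])); first by rewrite self_similar_hull.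
  apply: le_pr => // x /=; rewrite !in_itv/= => /andP[h1 h2].
  by have H0 := hull_gt0 N4 d0; apply/andP; split; lra.
elim: n {hn} => [|n IH]; first by rewrite !expr0 !mul1r.
apply: le_trans IH; rewrite exprSr -mulrA ler_pM2l ?exprn_gt0//.
have -> : N ^+ n.+1 * e = N * (N ^+ n * e) by rewrite exprS mulrA.
set s := N ^+ n * e.
have mI : measurable (`[- s, s]%classic : set R) by [].
have := self_similarE mI.
have -> : [set x | `[- s, s]%classic (N^-1 * x + 0)] = `[- (N * s), N * s]%classic.
  by apply/seteqP; split => x /=; rewrite !in_itv/= addr0
    -[_ <= N^-1 * x](ler_pM2l N0) -[N^-1 * x <= _](ler_pM2l N0) mulVK mulrN.
by have := pr_ge0 P [set x | `[- s, s]%classic (N^-1 * x + N^-1 * d)]; lra.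
Qed.

(** A closed set of full mass missing [0] would miss a symmetric interval of positive mass. This
    provides the point of each support that puts [0] in both difference sets. *)
Lemma closed_support0 : closed_support P 0.
Proof.
move=> C [cC PC]; apply: contrapT => C0.
have : nbhs (0 : R) (~` C) by apply: open_nbhs_nbhs; split => //; exact: closed_openC.
move=> /nbhs_ballP[e /= e0 eC].
have mC : measurable C by exact: closed_measurable.
have e20 : 0 < e / 2 by rewrite divr_gt0.
have := self_similar_itv0_gt0 e20; rewrite (_ : pr P _ = 0) ?ltxx//.
apply: (@pr_full _ _ C) => //; first by rewrite /pr PC; exact: prT.
rewrite -subset0 => x [Cx /=]; rewrite in_itv/= -ler_norml => xe.
by apply: (eC x) => //; rewrite /ball/= sub0r normrN; lra.
Qed.

(** Level [n] is contained in both preimages of level [n.+1], so full mass passes from the hull to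
    every level. *)
Lemma pr_cantor_level n : pr P (cantor_level N d n) = 1.
Proof.
have mC := @measurable_cantor_level R N d.
elim: n => [|n IH]; first exact: self_similar_hull.
have := self_similarE (mC n.+1).
suff : 1 <= pr P [set x | cantor_level N d n.+1 (N^-1 * x + 0)] /\
       1 <= pr P [set x | cantor_level N d n.+1 (N^-1 * x + N^-1 * d)].
  by have := pr_le1 P (mC n.+1); lra.
rewrite -IH; split; apply: le_pr (mC n) _ _; try exact: measurable_preaffine (mC n.+1).
  by move=> x /= Cx; left; rewrite addr0 mulVK.
by move=> x /= Cx; right; rewrite mulrDr !mulVK addrK.
Qed.

Lemma pr_cantor : pr P (cantor N d) = 1.
Proof. exact: pr_bigcap (@measurable_cantor_level R N d) pr_cantor_level. Qed.

Lemma closed_support_cantor_level n : closed_support P `<=` cantor_level N d n.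
Proof.
move=> x; apply; split; first exact: closed_cantor_level.
transitivity (1%E : \bar R); last exact/esym/(@probability_setT _ _ _ P).
transitivity ((pr P (cantor_level N d n))%:E); last by rewrite pr_cantor_level.
by apply: prE; exact: measurable_cantor_level.
Qed.

End self_similar.

(** * The packing property *)

Section packing.
Context {R : realType}.

Lemma hull16_1 : hull 16 1 = 15^-1 :> R.
Proof. by rewrite /hull (_ : 16 - 1 = 15 :> R) ?mul1r//; lra. Qed.

Lemma hull16_4 : hull 16 4 = 4 / 15 :> R.
Proof. by rewrite /hull (_ : 16 - 1 = 15 :> R)//; lra. Qed.

Lemma hull4_1 : hull 4 1 = 3^-1 :> R.
Proof. by rewrite /hull (_ : 4 - 1 = 3 :> R) ?mul1r//; lra. Qed.

Lemma cantor_level_itv (N d x : R) n : 4 <= N -> 0 < d ->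
  cantor_level N d n x -> 0 <= x <= hull N d.
Proof. by move=> N4 d0 /(cantor_level_hull N4 d0)/=; rewrite in_itv. Qed.

Let N16 : 4 <= 16 :> R. Proof. by rewrite ler_nat. Qed.

(* Scaling by [16], the first digits contribute [e] with [|e| <= 1] on one side
   and [4 f] with [|f| <= 1] on the other, the tails less than [1] in total:
   hence [e = f = 0]. *)
Lemma packing_level (n : nat) (x y u v : R) :
  cantor_level 16 1 n x -> cantor_level 16 1 n y ->
  cantor_level 16 4 n u -> cantor_level 16 4 n v ->
  x - y = u - v -> `|x - y| <= 2^-1 ^+ n.
Proof.
elim: n x y u v => [|n IH] x y u v.
  move=> /(cantor_level_itv N16 ltr01) + /(cantor_level_itv N16 ltr01) + _ _ _.
  by rewrite hull16_1 ler_norml expr0 => /andP[? ?] /andP[? ?]; apply/andP; split; lra.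
(* The digit choices become disjunctions on the tails [x'], [y'], [u'], [v'], so that one statement
   serves all sixteen cases. *)
suff step x' y' u' v' : cantor_level 16 1 n x' -> cantor_level 16 1 n y' ->
    cantor_level 16 4 n u' -> cantor_level 16 4 n v' ->
    (x' = 16 * x \/ x' = 16 * x - 1) -> (y' = 16 * y \/ y' = 16 * y - 1) ->
    (u' = 16 * u \/ u' = 16 * u - 4) -> (v' = 16 * v \/ v' = 16 * v - 4) ->
    x - y = u - v -> `|x - y| <= 2^-1 ^+ n.+1.
  by move=> [] hx [] hy [] hu [] hv; apply: step hx hy hu hv _ _ _ _; tauto.
move=> hx hy hu hv ex ey eu ev xyuv.
have bx := cantor_level_itv N16 ltr01 hx.
have by_ := cantor_level_itv N16 ltr01 hy.
have bu := cantor_level_itv N16 (ltr0n _ 4) hu.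
have bv := cantor_level_itv N16 (ltr0n _ 4) hv.
have E : x' - y' = 16 * (x - y) /\ u' - v' = x' - y'.
  move: bx by_ bu bv; rewrite hull16_1 hull16_4.
  move=> /andP[? ?] /andP[? ?] /andP[? ?] /andP[? ?].
  by case: ex => ?; case: ey => ?; case: eu => ?; case: ev => ?; split; lra.
have := IH _ _ _ _ hx hy hu hv (esym E.2).
rewrite E.1 normrM ger0_norm//; have := normr_ge0 (x - y).
by rewrite exprS; lra.
Qed.

Lemma packing_cantor (x y u v : R) : cantor 16 1 x -> cantor 16 1 y ->
  cantor 16 4 u -> cantor 16 4 v -> x - y = u - v -> x = y.
Proof.
move=> hx hy hu hv xy; apply/eqP; rewrite -subr_eq0 -normr_le0.
apply: (@le0_expr2V _ _ 1) => n; rewrite mul1r.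
by apply: packing_level xy; [exact: hx|exact: hy|exact: hu|exact: hv].
Qed.

Lemma packing_pair_support (mu lam : probability R R) :
  self_similar 16 1 mu -> self_similar 16 4 lam ->
  packing_pair (closed_support mu) (closed_support lam).
Proof.
move=> hmu hlam; have mu0 := closed_support0 N16 ltr01 hmu.
have lam0 := closed_support0 N16 (ltr0n _ 4) hlam.
apply/seteqP; split => [z [[x hx [y hy <-]] [u hu [v hv /esym xyuv]]]|_ ->] /=.
  have sub_mu n := @closed_support_cantor_level _ _ _ _ N16 ltr01 hmu n.
  have sub_lam n := @closed_support_cantor_level _ _ _ _ N16 (ltr0n _ 4) hlam n.
  apply/eqP; rewrite -normr_le0; apply: (@le0_expr2V _ _ 1) => n; rewrite mul1r.
  by apply: packing_level xyuv; [exact: sub_mu|exact: sub_mu|exact: sub_lam|exact: sub_lam].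
by split; exists 0 => //; exists 0 => //; rewrite subrr.
Qed.

End packing.

(** * Translates of the one-sixteenth Cantor set are null for the one-fourth measure *)

Section thin.
Context {R : realType} {P : probability R R}.
Hypothesis ssP : self_similar 4 1 P.

Let N4 : 4 <= 4 :> R. Proof. by []. Qed.

Lemma measurable_cantor_level_affine (N d a b : R) n :
  measurable [set z | cantor_level N d n (a * z + b)].
Proof. by apply: measurable_preaffine; exact: measurable_cantor_level. Qed.

(* [2 ^ n] intervals of length [16 ^ -(n + m)], each of mass at most [4 ^ -(n + m)]. *)
Lemma pr_cantor_level_affine (n m : nat) (y : R) :
  pr P [set z | cantor_level 16 1 n (16 ^+ m * z + y)] <=
  2^-1 ^+ n * 4^-1 ^+ m.
Proof.
elim: n m y => [|n IH] m y.
  have e0 : 0 < 16 ^+ m :> R by rewrite exprn_gt0.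
  have -> : [set z | cantor_level 16 1 0 (16 ^+ m * z + y)] =
      `[(16 ^+ m)^-1 * (- y), (16 ^+ m)^-1 * (15^-1 - y)]%classic.
    apply/seteqP; split => z /=; rewrite !in_itv/= hull16_1
      -[_ * - y <= z](ler_pM2l e0) -[z <= _ * (_ - y)](ler_pM2l e0)
      !mulVKf ?gt_eqF//; lra.
  (* The interval has length [16 ^ -m / 15], at most [4 ^ -(2 m) / 2], so [self_similar_itv_le]
     applies at level [2 m]. *)
  rewrite expr0 mul1r (_ : 4^-1 = 2^-1 ^+ 2); last by rewrite exprVn -natrX.
  rewrite -exprM; apply: (self_similar_itv_le N4 ltr01 ssP).
  rewrite -mulrBr opprK subrK mulrC exprM (_ : 4^-1 ^+ 2 = 16^-1); last by rewrite exprVn -natrX.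
  by rewrite exprVn ler_pM2r ?invr_gt0//; lra.
have -> : [set z | cantor_level 16 1 n.+1 (16 ^+ m * z + y)] =
    [set z | cantor_level 16 1 n (16 ^+ m.+1 * z + 16 * y)] `|`
    [set z | cantor_level 16 1 n (16 ^+ m.+1 * z + (16 * y - 1))].
  by apply/seteqP; split => z; rewrite /= exprS mulrDr !mulrA addrA.
apply: le_trans (prU _ _ _) _; try exact: measurable_cantor_level_affine.
have := IH m.+1 (16 * y); have := IH m.+1 (16 * y - 1).
rewrite (_ : 2^-1 ^+ n * 4^-1 ^+ m.+1 = 4^-1 * (2^-1 ^+ n * 4^-1 ^+ m)); last first.
  by rewrite exprS mulrCA.
rewrite (_ : 2^-1 ^+ n.+1 * 4^-1 ^+ m = 2^-1 * (2^-1 ^+ n * 4^-1 ^+ m)); last first.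
  by rewrite exprS mulrA.
lra.
Qed.

Lemma measurable_cantor_affine (N d a b : R) :
  measurable [set z | cantor N d (a * z + b)].
Proof. by apply: measurable_preaffine; exact: measurable_cantor. Qed.

(** The previous bound at [m = 0], with [n] arbitrarily large. It separates the two summands of the
    mixture and is reused for the sets [K + s] in the singularity argument. *)
Lemma pr_cantor_translate (y : R) : pr P [set z | cantor 16 1 (z + y)] = 0.
Proof.
apply/eqP; rewrite eq_le pr_ge0 andbT; apply: (@le0_expr2V _ _ 1) => n.
rewrite mul1r; have := pr_cantor_level_affine n 0 y; rewrite !expr0 mulr1.
apply: le_trans; apply: le_pr; last by move=> z; rewrite /= mul1r => /(_ n I).
  by have := measurable_cantor_affine 16 1 1 y; under eq_set do rewrite mul1r.
exact: measurable_cantor_level_affine.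
Qed.

End thin.

(** * Fourier transforms of self-similar measures *)

Section bounded_integral.
Context {R : realType}.
Implicit Types (P : probability R R) (f g : R -> R).

Definition bounded_measurable f := measurable_fun setT f /\ forall x, `|f x| <= 1.

Lemma bounded_measurable_integrable (m : {finite_measure set R -> \bar R}) f :
  bounded_measurable f -> m.-integrable setT (EFin \o f).
Proof.
move=> [mf bf]; apply: measurable_bounded_integrable => //.
  by rewrite -ge0_fin_numE// fin_num_measure.
exists 1; split; rewrite ?num_real// => M M1 x _ /=.
exact: le_trans (bf x) (ltW M1).
Qed.

Lemma bounded_measurable_affine f (a b : R) : bounded_measurable f ->
  bounded_measurable (fun x => f (a * x + b)).
Proof.
move=> [mf bf]; split => //.
by apply: (measurableT_comp mf); exact: measurable_affine.
Qed.

Lemma eq_Rintegral_full P f g (A : set R) :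
  bounded_measurable f -> bounded_measurable g -> measurable A -> pr P A = 1 ->
  {in A, f =1 g} -> \int[P]_x f x = \int[P]_x g x.
Proof.
move=> [mf _] [mg _] mA A1 fg; congr fine; apply: ae_eq_integral => //.
- exact/measurable_EFinP.
- exact/measurable_EFinP.
- exists (~` A); split; first exact: measurableC.
    by apply: pr_eq0; [rewrite prC// A1 subrr|exact: measurableC].
  by move=> x /=; apply: contra_not => Ax _; rewrite fg// inE.
Qed.

Lemma normr_Rintegral_le1 P f : bounded_measurable f -> `|\int[P]_x f x| <= 1.
Proof.
move=> bf; have := le_normr_Rintegral measurableT (bounded_measurable_integrable P bf).
move=> /le_trans; apply.
have b1 : bounded_measurable (cst 1) by split => // x; rewrite normr1.
have bn : bounded_measurable (fun x => `|f x|).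
  by case: bf => mf bf; split=> [|x]; [exact: measurableT_comp|rewrite normr_id].
have -> : 1 = \int[P]_x (cst 1 x) :> R.
  by rewrite Rintegral_cst//= mul1r; exact/esym/prT.
apply: le_Rintegral => //; try exact: bounded_measurable_integrable.
by move=> x _; exact: bf.2.
Qed.

(** By self-similarity [P + P] and the sum of the two pushforwards of [P] are the same measure,
    hence have the same integrals. *)
Lemma self_similar_Rintegral (N d : R) P f : 4 <= N -> self_similar N d P ->
  bounded_measurable f ->
  2 * \int[P]_x f x =
  \int[P]_x f (N^-1 * x + 0) + \int[P]_x f (N^-1 * x + N^-1 * d).
Proof.
move=> N4 ssP bf.
pose push b : {measure set R -> \bar R} :=
  measure_function_pushforward__canonical__measure_function_Measure
     P (measurable_affine N^-1 b).
have pushE b : (\int[push b]_x (f x)%:E = (\int[P]_x f (N^-1 * x + b))%:E)%E.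
  rewrite integral_pushforward//; last 3 first.
  - exact: measurable_affine.
  - by apply/measurable_EFinP; exact: bf.1.
  - exact/bounded_measurable_integrable/bounded_measurable_affine.
  rewrite /Rintegral fineK//; apply: integrable_fin_num => //.
  exact/bounded_measurable_integrable/bounded_measurable_affine.
have push_int b : (push b).-integrable setT (EFin \o f).
  apply: integrable_pushforward => //.
  - exact: measurable_affine.
  - by apply/measurable_EFinP; exact: bf.1.
  - exact/bounded_measurable_integrable/bounded_measurable_affine.
have Pint := bounded_measurable_integrable P bf.
apply: EFin_inj; rewrite EFinD -!pushE mulr_natl mulr2n EFinD.
rewrite -(integral_measure_add measurableT (push_int _) (push_int _)).
have -> : (\int[P]_x f x)%:E = (\int[P]_x (f x)%:E)%E.
  by rewrite /Rintegral fineK//; exact: integrable_fin_num.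
rewrite -(integral_measure_add measurableT Pint Pint).
apply: eq_measure_integral => A mA _.
transitivity (P A + P A)%E; first exact: measure_addE.
transitivity (push 0%R A + push (N^-1 * d)%R A)%E; last exact/esym/measure_addE.
rewrite /= /pushforward.
have := self_similarE N4 ssP mA.
rewrite !prE//; [|exact: measurable_preaffine..].
by rewrite -!EFinD => h; congr EFin; rewrite -h; lra.
Qed.

End bounded_integral.

Section energy.
Context {R : realType}.
Implicit Types (m : {measure set R -> \bar R}) (P : probability R R) (G : set R) (xi : R).

Definition cos_integral m G xi : R := \int[m]_x (\1_G x * cos (xi * x)).
Definition sin_integral m G xi : R := \int[m]_x (\1_G x * sin (xi * x)).

(** The squared modulus of the Fourier transform of [\1_G dm], at angular frequency [xi]: the factor
    [2 pi] is left out. *)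
Definition energy m G xi : R := cos_integral m G xi ^+ 2 + sin_integral m G xi ^+ 2.

Lemma energy_ge0 m G xi : 0 <= energy m G xi.
Proof. by rewrite addr_ge0 ?sqr_ge0. Qed.

Lemma bounded_measurable_indicM G (h : R -> R) xi : measurable G -> continuous h ->
  (forall x, `|h x| <= 1) -> bounded_measurable (fun x => \1_G x * h (xi * x)).
Proof.
move=> mG ch h1; split=> [|x].
  apply: measurable_funM; first exact: measurable_indic.
  apply: (measurableT_comp (continuous_measurable_fun ch)).
  by have := measurable_affine xi 0; under eq_fun do rewrite addr0.
rewrite normrM -[leRHS]mulr1 ler_pM//.
by rewrite indicE; case: (x \in G); rewrite ?normr1// normr0.
Qed.

Let bm_cos G xi : measurable G -> bounded_measurable (fun x => \1_G x * cos (xi * x)).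
Proof.
by move=> mG; apply: bounded_measurable_indicM => //; [exact: continuous_cos|exact: cos_max].
Qed.

Let bm_sin G xi : measurable G -> bounded_measurable (fun x => \1_G x * sin (xi * x)).
Proof.
by move=> mG; apply: bounded_measurable_indicM => //; [exact: continuous_sin|exact: sin_max].
Qed.

Lemma energy_le2 P G xi : measurable G -> energy P G xi <= 2.
Proof.
move=> mG; have sq1 (a : R) : `|a| <= 1 -> a ^+ 2 <= 1.
  by move=> a1; rewrite -real_normK ?num_real// expr_le1.
have := sq1 _ (normr_Rintegral_le1 P (bm_cos xi mG)).
have := sq1 _ (normr_Rintegral_le1 P (bm_sin xi mG)).
rewrite /energy /cos_integral /sin_integral; lra.
Qed.

Lemma eq_cos_sin_integral P (A G G' : set R) xi : measurable A -> pr P A = 1 ->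
  measurable G -> measurable G' -> (forall x, A x -> (G x <-> G' x)) ->
  cos_integral P G xi = cos_integral P G' xi /\
  sin_integral P G xi = sin_integral P G' xi.
Proof.
move=> mA A1 mG mG' GG'; rewrite /cos_integral /sin_integral.
have GE x : x \in A -> \1_G x = \1_G' x :> R.
  move=> /set_mem/GG' [h1 h2]; rewrite !indicE; congr ((nat_of_bool _)%:R).
  by apply/idP/idP => /set_mem h; apply/mem_set; tauto.
split.
- by apply: (eq_Rintegral_full (bm_cos _ mG) (bm_cos _ mG') mA A1) => x xA; rewrite GE.
- by apply: (eq_Rintegral_full (bm_sin _ mG) (bm_sin _ mG') mA A1) => x xA; rewrite GE.
Qed.

Lemma eq_energy P (A G G' : set R) xi : measurable A -> pr P A = 1 ->
  measurable G -> measurable G' -> (forall x, A x -> (G x <-> G' x)) ->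
  energy P G xi = energy P G' xi.
Proof.
move=> mA A1 mG mG' GG'; rewrite /energy.
by have [-> ->] := eq_cos_sin_integral xi mA A1 mG mG' GG'.
Qed.

Lemma cos_sin_integral0 P xi : cos_integral P set0 xi = 0 /\ sin_integral P set0 xi = 0.
Proof.
by split; rewrite /cos_integral /sin_integral; under eq_Rintegral do rewrite indic0 mul0r;
  rewrite Rintegral_cst//= mul0r.
Qed.

Section self_similar_energy.
Context {N d : R} {P : probability R R}.
Hypothesis N4 : 4 <= N.
Hypothesis d0 : 0 < d.
Hypothesis ssP : self_similar N d P.

Let mhull : measurable (`[0, hull N d]%classic : set R). Proof. by []. Qed.

(** Real and imaginary parts of one complex identity: the first branch contributes the transform
    over [G0], the second that over [G1] rotated by the angle [t]. *)
Lemma self_similar_cos_sin G xi : measurable G ->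
  let G0 := [set x | G (N^-1 * x + 0)] in
  let G1 := [set x | G (N^-1 * x + N^-1 * d)] in
  let t := xi / N * d in
  2 * cos_integral P G xi = cos_integral P G0 (xi / N) +
    (cos t * cos_integral P G1 (xi / N) - sin t * sin_integral P G1 (xi / N)) /\
  2 * sin_integral P G xi = sin_integral P G0 (xi / N) +
    (cos t * sin_integral P G1 (xi / N) + sin t * cos_integral P G1 (xi / N)).
Proof.
move=> mG G0 G1 t.
have mG1 : measurable G1 by exact: measurable_preaffine.
rewrite /cos_integral /sin_integral.
have iC := bounded_measurable_integrable P (bm_cos (xi / N) mG1).
have iS := bounded_measurable_integrable P (bm_sin (xi / N) mG1).
have iZ r f : P.-integrable setT (EFin \o f) -> P.-integrable setT (EFin \o (fun x => r * f x)).
  by move=> h; have := integrableZl measurableT r h; congr (P.-integrable _ _).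
rewrite (self_similar_Rintegral N4 ssP (bm_cos xi mG)).
rewrite (self_similar_Rintegral N4 ssP (bm_sin xi mG)).
have E x : xi * (N^-1 * x + N^-1 * d) = xi / N * x + t by rewrite /t; ring.
have E0 x : xi * (N^-1 * x + 0) = xi / N * x by ring.
split; congr (_ + _).
- by apply: eq_Rintegral => x _; rewrite E0.
- rewrite -!RintegralZl// -RintegralB//; try exact: iZ.
  by apply: eq_Rintegral => x _; rewrite E cosD /G1/= !indicE; ring.
- by apply: eq_Rintegral => x _; rewrite E0.
- rewrite -!RintegralZl// -RintegralD//; try exact: iZ.
  by apply: eq_Rintegral => x _; rewrite E sinD /G1/= !indicE; ring.
Qed.

Let hull_cos_sin G G' xi a : measurable G -> measurable G' ->
  (forall x, 0 <= x <= hull N d -> G (N^-1 * x + a) <-> G' x) ->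
  let Ga := [set x | G (N^-1 * x + a)] in
  cos_integral P Ga xi = cos_integral P G' xi /\
  sin_integral P Ga xi = sin_integral P G' xi.
Proof.
move=> mG mG' GG'; apply: (eq_cos_sin_integral xi mhull (self_similar_hull N4 d0 ssP)) => //.
exact: measurable_preaffine.
Qed.

(** Both branches see the same set [G'], so the transform is multiplied by [(1 + e^(it)) / 2] with
    [t = xi d / N], of squared modulus [(1 + cos t) / 2]. *)
Lemma energy_both G G' xi : measurable G -> measurable G' ->
  (forall x, 0 <= x <= hull N d -> G (N^-1 * x + 0) <-> G' x) ->
  (forall x, 0 <= x <= hull N d -> G (N^-1 * x + N^-1 * d) <-> G' x) ->
  energy P G xi = (1 + cos (xi / N * d)) / 2 * energy P G' (xi / N).
Proof.
move=> mG mG' h0 h1; have [] := self_similar_cos_sin xi mG.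
rewrite (hull_cos_sin _ mG mG' h0).1 (hull_cos_sin _ mG mG' h0).2.
rewrite (hull_cos_sin _ mG mG' h1).1 (hull_cos_sin _ mG mG' h1).2 /energy.
have := cos2Dsin2 (xi / N * d).
move: (cos_integral P G xi) (sin_integral P G xi) => C S.
move: (cos_integral P G' _) (sin_integral P G' _) => C' S'.
move: (cos _) (sin _) => c s cs hC hS.
transitivity (((2 * C) ^+ 2 + (2 * S) ^+ 2) / 4); first by field.
rewrite hC hS.
transitivity ((1 + 2 * c + (c ^+ 2 + s ^+ 2)) / 4 * (C' ^+ 2 + S' ^+ 2)); first by field.
by rewrite cs; field.
Qed.

(** Only the first branch meets [G]: the transform is halved. *)
Lemma energy_first G G' xi : measurable G -> measurable G' ->
  (forall x, 0 <= x <= hull N d -> G (N^-1 * x + 0) <-> G' x) ->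
  (forall x, 0 <= x <= hull N d -> ~ G (N^-1 * x + N^-1 * d)) ->
  energy P G xi = 4^-1 * energy P G' (xi / N).
Proof.
move=> mG mG' h0 h1; have [] := self_similar_cos_sin xi mG.
have {}h1 x : 0 <= x <= hull N d -> G (N^-1 * x + N^-1 * d) <-> set0 x.
  by move=> /h1; split.
rewrite (hull_cos_sin _ mG mG' h0).1 (hull_cos_sin _ mG mG' h0).2.
rewrite (hull_cos_sin _ mG measurable0 h1).1 (hull_cos_sin _ mG measurable0 h1).2.
rewrite (cos_sin_integral0 P _).1 (cos_sin_integral0 P _).2 /energy => hC hS.
transitivity (((2 * cos_integral P G xi) ^+ 2 + (2 * sin_integral P G xi) ^+ 2) / 4).
  by field.
by rewrite hC hS; field.
Qed.

End self_similar_energy.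
End energy.

(* The points of the hull of the Cantor set of ratio [1/4] whose first [n] digits
   of odd rank vanish; those are the digits carried by [lam16]. *)
Fixpoint odd_free {R : realType} (n : nat) : set R :=
  if n is m.+1 then
    [set x | odd_free m (4 * (4 * x)) \/ odd_free m (4 * (4 * x) - 1)]
  else `[0, 3^-1]%classic.

(** * Transforms of the one-fourth measure on the sets with vanishing odd digits *)

Section odd_free.
Context {R : realType}.

(** What remains of [odd_free n.+1] after its forced zero digit: one free digit, then a point of
    [odd_free n]. It splits a step of ratio 1/16 into two steps of ratio 1/4. *)
Let even_step n : set R := [set x | odd_free n (4 * x) \/ odd_free n (4 * x - 1)].

Lemma odd_free_itv n (x : R) : odd_free n x -> 0 <= x <= 3^-1.
Proof.
elim: n x => [x /=|n IH x /=]; first by rewrite in_itv.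
by move=> [] /IH/andP[? ?]; apply/andP; split; lra.
Qed.

Lemma measurable_odd_free n : measurable (odd_free n : set R).
Proof.
elim: n => [|n IH]; first exact: measurable_itv.
have := measurableU _ _ (measurable_preaffine 16 0 IH) (measurable_preaffine 16 (-1) IH).
congr measurable; apply/seteqP; split => x /=; rewrite addr0 mulrA;
  by rewrite (_ : 4 * 4 = 16 :> R)//; lra.
Qed.

Let measurable_even_step n : measurable (even_step n).
Proof.
have mG := measurable_odd_free n.
have := measurableU _ _ (measurable_preaffine 4 0 mG) (measurable_preaffine 4 (-1) mG).
by congr measurable; apply/seteqP; split => x /=; rewrite addr0.
Qed.

Let odd_free0 n (x : R) : odd_free n.+1 (4^-1 * x + 0) <-> even_step n x.
Proof. by rewrite /= (_ : 4 * (4 * _) = 4 * x)//; lra. Qed.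

Let odd_free1 n (x : R) : 0 <= x <= 3^-1 -> ~ odd_free n.+1 (4^-1 * x + 4^-1 * 1).
Proof.
rewrite /= (_ : 4 * (4 * (_ + _)) = 4 * (x + 1)); last by lra.
by move=> /andP[? ?] [] /odd_free_itv/andP[? ?]; lra.
Qed.

Let even_step0 n (x : R) : 0 <= x <= 3^-1 ->
  even_step n (4^-1 * x + 0) <-> odd_free n x.
Proof.
move=> /andP[? ?]; rewrite /even_step/= (_ : 4 * _ = x); last by lra.
split; last by left.
by move=> [//|/odd_free_itv/andP[? ?]]; lra.
Qed.

Let even_step1 n (x : R) : 0 <= x <= 3^-1 ->
  even_step n (4^-1 * x + 4^-1 * 1) <-> odd_free n x.
Proof.
move=> /andP[? ?]; rewrite /even_step/= (_ : 4 * _ = x + 1); last by lra.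
rewrite addrK; split; last by right.
by move=> [/odd_free_itv/andP[? ?]|//]; lra.
Qed.

Context {mu4 mu16 : probability R R}.
Hypothesis ss4 : self_similar 4 1 mu4.
Hypothesis ss16 : self_similar 16 1 mu16.

Let N4 : 4 <= 4 :> R. Proof. by []. Qed.
Let N16 : 4 <= 16 :> R. Proof. by rewrite ler_nat. Qed.

Let mhull : measurable (`[0, hull 4 1]%classic : set R). Proof. by []. Qed.
Let hull1 := self_similar_hull N4 ltr01 ss4.

Let eq_pr (G G' : set R) : measurable G -> measurable G' ->
  (forall x, 0 <= x <= 3^-1 -> G x <-> G' x) -> pr mu4 G = pr mu4 G'.
Proof.
move=> mG mG' GG'; rewrite -(pr_setI mG mhull hull1) -(pr_setI mG' mhull hull1).
congr pr; apply/seteqP; split => x [hG]; rewrite /= in_itv/= hull4_1 => hx;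
  by split=> //; have := GG' x hx; tauto.
Qed.

(** A forced zero digit halves the mass, a free digit preserves it. *)
Lemma pr_odd_free n : pr mu4 (odd_free n) = 2^-1 ^+ n.
Proof.
elim: n => [|n IH]; first by have := hull1; rewrite hull4_1.
have mG := measurable_odd_free n; have mG1 := measurable_odd_free n.+1.
have mH := measurable_even_step n.
have := self_similarE N4 ss4 mG1; have := self_similarE N4 ss4 mH.
have -> : pr mu4 [set x | odd_free n.+1 (4^-1 * x + 0)] = pr mu4 (even_step n).
  by apply: eq_pr; [exact: measurable_preaffine|by []|move=> x _; exact: odd_free0].
have -> : pr mu4 [set x | odd_free n.+1 (4^-1 * x + 4^-1 * 1)] = pr mu4 set0.
  by apply: eq_pr; [exact: measurable_preaffine|by []|move=> x /odd_free1 h; split => // /h].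
have -> : pr mu4 [set x | even_step n (4^-1 * x + 0)] = pr mu4 (odd_free n).
  by apply: eq_pr; [exact: measurable_preaffine|by []|move=> x; exact: even_step0].
have -> : pr mu4 [set x | even_step n (4^-1 * x + 4^-1 * 1)] = pr mu4 (odd_free n).
  by apply: eq_pr; [exact: measurable_preaffine|by []|move=> x; exact: even_step1].
by rewrite IH [pr _ set0]/pr measure0/= exprS; lra.
Qed.

(** The factor 1/4 comes from the forced zero digit, the cosine factor from the free one. *)
Lemma energy_odd_free_step n xi : energy mu4 (odd_free n.+1) xi =
  4^-1 * ((1 + cos (xi / 16)) / 2 * energy mu4 (odd_free n) (xi / 16)).
Proof.
have mG := measurable_odd_free n; have mG1 := measurable_odd_free n.+1.
have mH := measurable_even_step n.
rewrite (energy_first N4 ltr01 ss4 _ mG1 mH); last 2 first.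
- by move=> x _; exact: odd_free0.
- by move=> x; rewrite hull4_1; exact: odd_free1.
rewrite (energy_both N4 ltr01 ss4 _ mH mG); last 2 first.
- by move=> x; rewrite hull4_1; exact: even_step0.
- by move=> x; rewrite hull4_1; exact: even_step1.
by rewrite mulr1 -[xi / 4 / 4]mulrA -invfM (_ : 4 * 4 = 16 :> R)//; lra.
Qed.

Lemma energy_setT_step (N d : R) (P : probability R R) xi : 4 <= N -> 0 < d ->
  self_similar N d P ->
  energy P setT xi = (1 + cos (xi / N * d)) / 2 * energy P setT (xi / N).
Proof. by move=> hN hd ssP; exact: energy_both. Qed.

(** On the hull [[0, 1/15]] the phase stays in [[-1, 1]], where the cosine is at least [cos 1 > 0];
    the real part alone gives the bound. *)
Lemma energy_mu16_ge xi : `|xi| <= 1 -> cos 1 ^+ 2 <= energy mu16 setT xi.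
Proof.
move=> xi1; have hullT := self_similar_hull N16 ltr01 ss16.
have mI : measurable (`[0, hull 16 1]%classic : set R) by [].
rewrite -(@eq_energy _ mu16 `[0, hull 16 1] `[0, hull 16 1] setT xi mI hullT)//.
have c0 : 0 <= cos 1 :> R by rewrite ltW// cos1_gt0.
suff c1 : cos 1 <= cos_integral mu16 `[0, hull 16 1] xi.
  rewrite /energy -[leLHS]addr0 lerD ?sqr_ge0// lerXn2r ?nnegrE//.
  exact: le_trans c1.
have bc : bounded_measurable (cst (cos 1) : R -> R) by split => // x; exact: cos_max.
have bm (h : R -> R) : continuous h -> (forall x, `|h x| <= 1) ->
    bounded_measurable (fun x => \1_(`[0, hull 16 1]%classic : set R) x * h (xi * x)).
  exact: bounded_measurable_indicM.
have bcos := bm _ (@continuous_cos R) (@cos_max R).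
have bcst : bounded_measurable (fun x => \1_(`[0, hull 16 1]%classic : set R) x * cos 1).
  exact: (bm (cst (cos 1)) (fun=> cvg_cst _) (fun=> cos_max _)).
rewrite [leLHS](_ : _ = \int[mu16]_x (\1_(`[0, hull 16 1]%classic : set R) x * cos 1)).
  rewrite /cos_integral; apply: le_Rintegral => //.
  - exact: bounded_measurable_integrable.
  - exact: bounded_measurable_integrable.
  move=> x _; rewrite indicE; case: (boolP (_ \in _)); rewrite ?mul0r// !mul1r.
  move=> /set_mem/=; rewrite in_itv/= hull16_1 => /andP[x0 x1].
  rewrite -[leRHS]cos_norm; have : `|xi * x| <= 1.
    by rewrite normrM (ger0_norm x0) mulr_ile1//; lra.
  rewrite le_eqVlt => /predU1P[->//|xix1]; apply: ltW.
  by have pi2 := pi_ge2 R; rewrite ltr_cos// in_itv/= ?normr_ge0//=; lra.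
transitivity (\int[mu16]_x (cst (cos 1) x)).
  by rewrite Rintegral_cst// [X in _ * X](_ : _ = 1) ?mulr1//; exact: (prT mu16).
apply: (eq_Rintegral_full bc bcst mI hullT) => x xI.
by rewrite indicE xI mul1r.
Qed.

(* Both sides obey the same recursion under [xi |-> xi / 16], up to the factor
   [(1 + cos (xi / 4)) / 2 <= 1] on the left; near [0] the right side is bounded below. *)
Lemma energy_mu4_le xi :
  energy mu4 setT xi <= 2 / cos 1 ^+ 2 * energy mu16 setT xi.
Proof.
have c0 : 0 < cos 1 ^+ 2 :> R by rewrite exprn_gt0// cos1_gt0.
have [n] := exists_expr_ge N16 `|xi| ltr01; rewrite mulr1.
elim: n xi => [|n IH] xi hxi.
  have := energy_mu16_ge hxi; have := energy_le2 mu4 xi measurableT.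
  move=> h1 h2; apply: le_trans h1 _.
  by rewrite mulrAC ler_pdivlMr// ler_pM2l.
rewrite (energy_setT_step xi N16 ltr01 ss16) (energy_setT_step xi N4 ltr01 ss4).
rewrite (energy_setT_step (xi / 4) N4 ltr01 ss4) !mulr1 -[xi / 4 / 4]mulrA -invfM.
rewrite (_ : 4 * 4 = 16 :> R); last by lra.
have {}IH : energy mu4 setT (xi / 16) <= 2 / cos 1 ^+ 2 * energy mu16 setT (xi / 16).
  by apply: IH; rewrite normrM [`|16^-1|]ger0_norm// ler_pdivrMr// -exprSr.
have e0 := energy_ge0 mu4 setT (xi / 16).
have [a0 a1] : 0 <= (1 + cos (xi / 4)) / 2 /\ (1 + cos (xi / 4)) / 2 <= 1.
  by have := cos_le1 (xi / 4); have := cos_geN1 (xi / 4); split; lra.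
have b0 : 0 <= (1 + cos (xi / 16)) / 2 by have := cos_geN1 (xi / 16); lra.
rewrite [leRHS]mulrCA.
apply: (@le_trans _ _ ((1 + cos (xi / 16)) / 2 * energy mu4 setT (xi / 16))).
  by rewrite ler_piMl// mulr_ge0.
by rewrite ler_wpM2l.
Qed.

(** The transform of [mu16] has the same cosine factor in its recursion, so each step gains exactly
    1/4 over [energy_mu4_le]. *)
Lemma energy_odd_free_le n xi : energy mu4 (odd_free n) xi <=
  4^-1 ^+ n * (2 / cos 1 ^+ 2 * energy mu16 setT xi).
Proof.
elim: n xi => [|n IH] xi.
  rewrite expr0 mul1r; apply: le_trans (energy_mu4_le xi).
  by rewrite (@eq_energy _ mu4 _ (odd_free 0) setT xi mhull hull1)//= hull4_1.
rewrite energy_odd_free_step (energy_setT_step xi N16 ltr01 ss16) mulr1.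
rewrite exprS -[leRHS]mulrA ler_pM2l// ![in leRHS](mulrCA _ ((1 + cos _) / 2)).
by apply: ler_wpM2l (IH _); have := cos_geN1 (xi / 16); lra.
Qed.

End odd_free.

(** * Failure of the frame inequality *)

(* Unlike [ge0_le_integral], no measurability is needed: both sides are suprema
   over simple functions below. *)
Lemma le_integral_nonmeasurable d (T : measurableType d) (R : realType)
    (m : {measure set T -> \bar R}) (f g : T -> \bar R) :
  (forall x, 0 <= f x)%E -> (forall x, f x <= g x)%E ->
  (\int[m]_x f x <= \int[m]_x g x)%E.
Proof.
move=> f0 fg; rewrite !ge0_integralTE//; last by move=> x; exact: le_trans (fg x).
by apply: le_ereal_sup => _ [h hf <-]; exists h => // x; exact: le_trans (fg x).
Qed.

Section test_functions.
Context {R : realType}.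
Implicit Types (rho : {finite_measure set R -> \bar R}) (G : set R) (c xi : R).

Definition cindic c G : R -> R[i] := fun x => Complex (c * \1_G x) 0.

Lemma normL2_sq_cindic rho c G : measurable G ->
  normL2_sq rho (cindic c G) = ((c ^+ 2)%:E * rho G)%E.
Proof.
move=> mG; rewrite /normL2_sq.
transitivity (\int[rho]_x ((c ^+ 2)%:E * (\1_G x)%:E))%E.
  apply: eq_integral => x _; rewrite /= expr0n/= addr0 sqr_sqrtr ?sqr_ge0//.
  by rewrite -EFinM exprMn indicE; case: (x \in G); rewrite ?expr1n ?expr0n.
rewrite ge0_integralZl_EFin ?sqr_ge0//; last by apply/measurable_EFinP; exact: measurable_indic.
by rewrite integral_indic// setIT.
Qed.

Lemma inL2_cindic rho c G : measurable G -> inL2 rho (cindic c G).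
Proof.
move=> mG; split.
  split; last exact: measurable_cst.
  by apply: measurable_funM; [exact: measurable_cst|exact: measurable_indic].
rewrite normL2_sq_cindic//.
have : rho G \is a fin_num by exact: fin_num_measure.
by case: (rho G) => // r _; rewrite -EFinM ltry.
Qed.

Lemma fourier_cindic rho c G xi : measurable G ->
  Normc.normc (fourier rho (cindic c G) xi) ^+ 2 =
  c ^+ 2 * energy rho G (- (2 * pi * xi)).
Proof.
move=> mG; rewrite /fourier /cintegral /= sqr_sqrtr ?addr_ge0 ?sqr_ge0//.
set eta := - (2 * pi * xi).
have E x : - (2 * pi * (xi * x)) = eta * x by rewrite /eta; ring.
have Z (h : R -> R) : continuous h -> (forall x, `|h x| <= 1) ->
    \int[rho]_x (c * (\1_G x * h (eta * x))) = c * \int[rho]_x (\1_G x * h (eta * x)).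
  move=> ch h1; apply: RintegralZl => //; apply: bounded_measurable_integrable.
  exact: bounded_measurable_indicM.
transitivity ((c * cos_integral rho G eta) ^+ 2 + (c * sin_integral rho G eta) ^+ 2).
  rewrite /cos_integral /sin_integral -(Z _ (@continuous_cos R) (@cos_max R)).
  rewrite -(Z _ (@continuous_sin R) (@sin_max R)).
  by congr (_ ^+ 2 + _ ^+ 2); apply: eq_Rintegral => x _; rewrite E; ring.
by rewrite /energy; ring.
Qed.

Lemma eq_energy_measure (m1 m2 : {measure set R -> \bar R}) G xi : measurable G ->
  (forall A, measurable A -> A `<=` G -> m1 A = m2 A) ->
  energy m1 G xi = energy m2 G xi.
Proof.
move=> mG m12.
have E (h : R -> R) : \int[m1]_x (\1_G x * h x) = \int[m2]_x (\1_G x * h x).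
  have R1 (m : {measure set R -> \bar R}) :
      \int[m]_x (\1_G x * h x) = \int[m]_(x in G) h x.
    rewrite [RHS]Rintegral_mkcond; apply: eq_Rintegral => x _.
    by rewrite patchE indicE; case: ifP => _; rewrite ?mul1r ?mul0r.
  by rewrite !R1; congr fine; apply: eq_measure_integral => A mA AG; exact: m12.
by rewrite /energy /cos_integral /sin_integral !(E (fun x => cos (xi * x)))
  !(E (fun x => sin (xi * x))).
Qed.

Lemma measurable_translate (a : R) G : measurable G -> measurable [set x | G (x + a)].
Proof.
by move=> mG; have := measurable_preaffine 1 a mG; under eq_set do rewrite mul1r.
Qed.

Lemma translate_Rintegral (P : probability R R) (a : R) (f : R -> R) :
  bounded_measurable f ->
  \int[translate_measure a P]_x f x = \int[P]_x f (x + a).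
Proof.
move=> bf; congr fine.
have mt : measurable_fun setT (fun y : R => y + a).
  by have := measurable_affine 1 a; under eq_fun do rewrite mul1r.
have mf : measurable_fun setT (EFin \o f) by apply/measurable_EFinP; exact: bf.1.
apply: (integral_pushforward mt mf) => //.
apply: bounded_measurable_integrable.
by have := bounded_measurable_affine 1 a bf; under eq_fun do rewrite mul1r.
Qed.

(** Translation multiplies the transform by the unimodular factor [e^(i xi a)]. *)
Lemma energy_translate (P : probability R R) (a xi : R) G : measurable G ->
  energy (translate_measure a P) G xi = energy P [set x | G (x + a)] xi.
Proof.
move=> mG; have mGa := measurable_translate a mG.
have bcos H : measurable H -> bounded_measurable (fun x => \1_H x * cos (xi * x)).
  move=> mH; apply: bounded_measurable_indicM => //; first exact: continuous_cos.
  exact: cos_max.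
have bsin H : measurable H -> bounded_measurable (fun x => \1_H x * sin (xi * x)).
  move=> mH; apply: bounded_measurable_indicM => //; first exact: continuous_sin.
  exact: sin_max.
have iC := bounded_measurable_integrable P (bcos _ mGa).
have iS := bounded_measurable_integrable P (bsin _ mGa).
have iZ r f : P.-integrable setT (EFin \o f) -> P.-integrable setT (EFin \o (fun x => r * f x)).
  by move=> h; have := integrableZl measurableT r h; congr (P.-integrable _ _).
set Ga := [set x | G (x + a)]; pose t := xi * a.
rewrite {1}/energy.
have -> : cos_integral (translate_measure a P) G xi =
    cos t * cos_integral P Ga xi - sin t * sin_integral P Ga xi.
  rewrite /cos_integral (translate_Rintegral _ _ (bcos _ mG)).
  rewrite -!RintegralZl// -RintegralB//; try exact: iZ.
  by apply: eq_Rintegral => x _; rewrite mulrDr cosD -/t /Ga/= !indicE; ring.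
have -> : sin_integral (translate_measure a P) G xi =
    cos t * sin_integral P Ga xi + sin t * cos_integral P Ga xi.
  rewrite /sin_integral (translate_Rintegral _ _ (bsin _ mG)).
  rewrite -!RintegralZl// -RintegralD//; try exact: iZ.
  by apply: eq_Rintegral => x _; rewrite mulrDr sinD -/t /Ga/= !indicE; ring.
have := cos2Dsin2 t; rewrite /energy.
move: (cos t) (sin t) (cos_integral P _ _) (sin_integral P _ _) => c s C S cs.
transitivity ((c ^+ 2 + s ^+ 2) * (C ^+ 2 + S ^+ 2)); first by ring.
by rewrite cs mul1r.
Qed.

End test_functions.

Section mixture.
Context {R : realType} {mu4 mu16 : probability R R} {a : R}.
Hypothesis ss4 : self_similar 4 1 mu4.
Hypothesis ss16 : self_similar 16 1 mu16.

Let N16 : 4 <= 16 :> R. Proof. by rewrite ler_nat. Qed.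

Let rho : {finite_measure set R -> \bar R} :=
  sum_measure mu4 (translate_measure a mu16).
(** The set [a + K]: it carries the translate of [mu16] and is [mu4]-null, so [rho] is one summand
    on it and the other off it. *)
Let V : set R := [set z | cantor 16 1 (z - a)].

Let mixtureE (A : set R) : rho A = (mu4 A + mu16 [set y | A (y + a)%R])%E.
Proof. exact: measure_addE. Qed.

Let measurable_V : measurable V.
Proof. by apply: measurable_translate; exact: measurable_cantor. Qed.

Let mu4_V : pr mu4 V = 0.
Proof. exact: pr_cantor_translate. Qed.

Let translate_V : [set y | V (y + a)] = cantor 16 1.
Proof. by apply/seteqP; split => y /=; rewrite /V/= addrK. Qed.

Let mu16_V : pr mu16 [set y | V (y + a)] = 1.
Proof. by rewrite translate_V; exact: pr_cantor. Qed.

Lemma mixture_off_V (A : set R) : measurable A -> A `&` V = set0 -> rho A = mu4 A.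
Proof.
move=> mA AV; rewrite mixtureE; have mAa := measurable_translate a mA.
rewrite [X in (_ + X)%E](_ : _ = 0%E) ?adde0//; apply: pr_eq0 => //.
apply: pr_full mu16_V _ => //; first exact: measurable_translate.
rewrite -subset0 => y [Vy Ay]; suff : (A `&` V) (y + a) by rewrite AV.
by split; [exact: Ay|exact: Vy].
Qed.

Lemma mixture_on_V (A : set R) : measurable A -> A `<=` V ->
  rho A = translate_measure a mu16 A.
Proof.
move=> mA AV; rewrite mixtureE.
rewrite [X in (X + _)%E](_ : _ = 0%E) ?add0e//; apply: pr_eq0 => //.
by apply/eqP; rewrite eq_le pr_ge0 andbT -mu4_V; exact: le_pr.
Qed.

(** Removing [V] makes [rho] coincide with [mu4] here, at no cost in [mu4]-mass. *)
Let test n : set R := odd_free n `\` V.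

Let measurable_test n : measurable (test n).
Proof. by apply: measurableD => //; exact: measurable_odd_free. Qed.

Let rho_test n : rho (test n) = (2^-1 ^+ n)%:E.
Proof.
rewrite mixture_off_V//; last by rewrite /test setDE -setIA setICl setI0.
rewrite prE// /test setDE pr_setI ?(pr_odd_free ss4)//.
- exact: measurable_odd_free.
- exact: measurableC.
- by rewrite prC// mu4_V subr0.
Qed.

Let rho_V : rho V = 1%E.
Proof.
by rewrite mixture_on_V// -[LHS]/(mu16 [set y | V (y + a)]) prE ?mu16_V//;
  exact: measurable_translate.
Qed.

Let energy_test n xi : energy rho (test n) xi = energy mu4 (odd_free n) xi.
Proof.
rewrite (@eq_energy_measure _ rho mu4)//; last first.
  move=> A mA AG; apply: mixture_off_V => //.
  by rewrite -subset0 => x [/AG[]].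
apply: (@eq_energy _ mu4 (~` V)).
- exact: measurableC.
- by rewrite prC// mu4_V subr0.
- exact: measurable_test.
- exact: measurable_odd_free.
- by move=> x Vx; rewrite /test; split => [[]|].
Qed.

Let energy_V xi : energy rho V xi = energy mu16 setT xi.
Proof.
rewrite (@eq_energy_measure _ rho (translate_measure a mu16))//; last first.
  by move=> A mA AV; exact: mixture_on_V.
rewrite energy_translate//; apply: (eq_energy xi _ mu16_V) => //; exact: measurable_translate.
Qed.

(* Multiplying the test function on [V] by [c = 4 ^ -(n / 2) K ^ (1 / 2)] makes its
   transform dominate pointwise that of the indicator of [test n], while the squared
   norms are [c ^ 2 = 4 ^ -n K] and [2 ^ -n]. *)
Lemma no_frame_measure (Gamma : {measure set R -> \bar R}) : ~ frame_measure rho Gamma.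
Proof.
move=> [_ [A [B [A0 AB frame]]]].
pose K : R := 2 / cos 1 ^+ 2.
have K0 : 0 < K by rewrite divr_gt0// exprn_gt0// cos1_gt0.
suff AKB n : A <= K * B * 2^-1 ^+ n.
  by have := le0_expr2V AKB; rewrite leNgt A0.
pose c : R := Num.sqrt (4^-1 ^+ n * K).
have c2 : c ^+ 2 = 4^-1 ^+ n * K by rewrite sqr_sqrtr// mulr_ge0 ?exprn_ge0// ltW.
have [lower _] := frame _ (inL2_cindic rho 1 (measurable_test n)).
have [_ upper] := frame _ (inL2_cindic rho c measurable_V).
have mid : (\int[Gamma]_xi (Normc.normc (fourier rho (cindic 1 (test n)) xi) ^+ 2)%:E <=
            \int[Gamma]_xi (Normc.normc (fourier rho (cindic c V) xi) ^+ 2)%:E)%E.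
  apply: le_integral_nonmeasurable => xi; first by rewrite lee_fin sqr_ge0.
  rewrite lee_fin !fourier_cindic// expr1n mul1r c2 energy_test energy_V -[leRHS]mulrA.
  exact: energy_odd_free_le.
have := le_trans lower (le_trans mid upper).
rewrite !normL2_sq_cindic// rho_test rho_V expr1n mul1e mule1 -!EFinM lee_fin c2.
(* The inequality is now [A 2^-n <= B 4^-n K]; writing [4^-n] as a square lets one factor [2^-n]
   cancel. *)
have -> : 4^-1 = 2^-1 ^+ 2 :> R by rewrite exprVn -natrX.
have e0 : 0 < 2^-1 ^+ n :> R by rewrite exprn_gt0.
by rewrite -exprM mulnC exprM expr2 => h; rewrite -(ler_pM2r e0); lra.
Qed.

End mixture.

(** * Convolution of self-similar measures *)

Section convolution.
Context {R : realType}.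
Implicit Types (P Q : probability R R) (E : set R).

(** Two parameters cover both the convolution, [(b, c) = (0, 1)], and the reflected translation,
    [(a, -1)], of the singularity argument. *)
Let shear (b c : R) E : set (R * R) := [set z | E (z.2 + (b + c * z.1))].

Let measurable_shear b c E : measurable E -> measurable (shear b c E).
Proof.
move=> mE; rewrite -[X in measurable X]setTI.
have : measurable_fun setT (fun z : R * R => z.2 + (b + c * z.1)).
  apply: measurable_funD; first exact: measurable_snd.
  apply: measurable_funD; first exact: measurable_cst.
  by apply: measurable_funM; [exact: measurable_cst|exact: measurable_fst].
exact.
Qed.

Lemma bounded_measurable_translate P E : measurable E ->
  bounded_measurable (fun s => pr P [set u | E (u + s)]).
Proof.
move=> mE; split=> [|s].
  have := measurable_fun_xsection P (measurable_shear 0 1 mE).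
  move=> /(measurableT_comp (fine_measurable measurableT)).
  congr measurable_fun; apply/funext => s /=; rewrite /pr xsectionE; congr (fine (P _)).
  by apply/seteqP; split => u; rewrite /shear/= add0r mul1r.
by rewrite ger0_norm ?pr_ge0// pr_le1//; exact: measurable_translate.
Qed.

Definition conv Q P E : R := \int[Q]_s pr P [set u | E (u + s)].

Lemma fubini_translate P Q E (b c : R) : measurable E ->
  (\int[Q]_s P [set u | E (u + (b + c * s))%R] =
   \int[P]_u Q [set s | E (u + (b + c * s))%R])%E.
Proof.
move=> mE; have mA := measurable_shear b c mE.
have := indic_fubini_tonelli Q P mA.
rewrite indic_fubini_tonelli_FE// indic_fubini_tonelli_GE//.
by under eq_integral do rewrite /= xsectionE; under [RHS]eq_integral do rewrite /= ysectionE.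
Qed.

(** The digits 0, 1 of [P] and 0, 4 of [Q] add up to 0, 1, 4, 5, which are the two-digit blocks of
    [mu4] in base 4. *)
Lemma self_similar_conv (P Q : probability R R) E : self_similar 16 1 P ->
  self_similar 16 4 Q -> measurable E ->
  let digit d := conv Q P [set y | E (16^-1 * y + 16^-1 * d)] in
  4 * conv Q P E = (digit 0 + digit 4) + (digit 1 + digit 5).
Proof.
move=> ssP ssQ mE digit; have N16 : 4 <= 16 :> R by rewrite ler_nat.
pose D a : set R := [set y | E (16^-1 * y + 16^-1 * a)].
have mD a : measurable (D a) by exact: measurable_preaffine.
(* Expanding [P] first produces the digit [a] and rescales the shift to [16 s]; expanding [Q] then
   replaces [16 s] by [s] or [s + 4]. *)
pose psi a s := pr P [set u | D a (u + (16 * s + 0))].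
have bpsi a : bounded_measurable (psi a).
  exact: (bounded_measurable_affine 16 0 (bounded_measurable_translate P (mD a))).
have psiE a : 2 * \int[Q]_s psi a s = digit a + digit (a + 4).
  rewrite (self_similar_Rintegral N16 ssQ (bpsi a)); congr (_ + _).
    apply: eq_Rintegral => s _; rewrite /psi.
    by rewrite (_ : 16 * (16^-1 * s + 0) + 0 = s)//; lra.
  apply: eq_Rintegral => s _; rewrite /psi.
  rewrite (_ : 16 * (16^-1 * s + 16^-1 * 4) + 0 = s + 4); last by lra.
  congr (pr P _); apply/seteqP; split => u; rewrite /D/=;
    by rewrite (_ : 16^-1 * (u + (s + 4)) + 16^-1 * a =
      16^-1 * (u + s) + 16^-1 * (a + 4))//; ring.
have E2 : 2 * conv Q P E = \int[Q]_s psi 0 s + \int[Q]_s psi 1 s.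
  rewrite -RintegralD//; try exact: bounded_measurable_integrable.
  rewrite /conv -RintegralZl//; last first.
    exact/bounded_measurable_integrable/bounded_measurable_translate.
  apply: eq_Rintegral => s _.
  rewrite (self_similarE N16 ssP (measurable_translate s mE)) /psi /D.
  congr (pr P _ + pr P _); apply/seteqP; split => u /=.
  - by rewrite (_ : 16^-1 * (u + (16 * s + 0)) + _ = 16^-1 * u + 0 + s)//; lra.
  - by rewrite (_ : 16^-1 * (u + (16 * s + 0)) + _ = 16^-1 * u + 0 + s)//; lra.
  - by rewrite (_ : 16^-1 * (u + (16 * s + 0)) + _ = 16^-1 * u + 16^-1 * 1 + s)//; lra.
  - by rewrite (_ : 16^-1 * (u + (16 * s + 0)) + _ = 16^-1 * u + 16^-1 * 1 + s)//; lra.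
have := psiE 0; have := psiE 1; rewrite add0r (_ : 1 + 4 = 5 :> R); last by lra.
by lra.
Qed.

Lemma conv_eq_const P Q E (B : set R) (c : R) : measurable E -> `|c| <= 1 ->
  measurable B -> pr Q B = 1 ->
  (forall s, B s -> pr P [set u | E (u + s)] = c) -> conv Q P E = c.
Proof.
move=> mE c1 mB B1 Ec.
have bc : bounded_measurable (cst c : R -> R) by split.
rewrite /conv (eq_Rintegral_full (bounded_measurable_translate P mE) bc mB B1).
  by rewrite Rintegral_cst// [X in _ * X](_ : _ = 1) ?mulr1//; exact: (prT Q).
by move=> s /set_mem; exact: Ec.
Qed.

End convolution.

(** Second countability: every point off the support has a null ball with rational centre and radius
    around it, and there are countably many of these. *)
Lemma closed_support_full (R : realType) (rho : {finite_measure set R -> \bar R}) :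
  rho (closed_support rho) = rho setT.
Proof.
set K := closed_support rho.
have cK : closed K by apply: closed_bigI => C [].
have mK : measurable K by exact: closed_measurable.
have mC (C : set R) : measurable C -> rho setT = (rho C + rho (~` C))%E.
  by move=> mC; rewrite -measureU ?setUCr ?setICr//; exact: measurableC.
rewrite (mC K mK) [X in (_ + X)%E](_ : _ = 0%E) ?adde0//.
pose B (q : rat * rat) : set R := ball (ratr q.1 : R) (ratr q.2).
(* Non-null balls are replaced by the empty set, so that the union over all codes is null. *)
pose F k : set R := if unpickle k is Some q then
  if rho (B q) == 0%E then B q else set0 else set0.
have mB q : measurable (B q) by apply: open_measurable; exact: ball_open.
have KF : ~` K `<=` \bigcup_k F k.
  move=> x; rewrite setC_bigcap => -[C [cC rC] Cx].
  have oC : open (~` C) by exact: closed_openC.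
  have [c [r [xB BC]]] := open_subball_rat oC (mem_set Cx).
  exists (pickle (c, r)); [exact: I | rewrite /F pickleK].
  suff -> : rho (B (c, r)) == 0%E by exact: set_mem.
  have mC' : measurable C by exact: closed_measurable.
  have finC : rho C \is a fin_num by exact: fin_num_measure.
  have : rho (~` C) = 0%E.
    have := mC C mC'; rewrite -rC -[in LHS](adde0 (rho C)) => /(congr1 (fun z => z - rho C)%E).
    by rewrite ![(rho C + _)%E]addeC !addeK// => <-.
  move=> C0; rewrite eq_le measure_ge0 andbT -C0 le_measure// ?inE//.
  exact: measurableC.
apply: measure_negligible; first exact: measurableC.
apply: negligibleS KF _; apply: negligible_bigcup => k; rewrite /F.
case: (unpickle k) => [q|]; last exact: negligible_set0.
by case: eqP => [h|_]; [exact/negligibleP|exact: negligible_set0].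
Qed.

(* [x0], .., [x5] stand for the gap between two distribution functions of measures on
   [0, 1/3], read at [r - d]; being nonzero only there, at most one of them is. *)
Lemma at_most_one_digit (R : realFieldType) (r e x0 x1 x4 x5 : R) :
  let inactive_or d x := x = 0 \/ (0 < r - d <= 3^-1) /\ (`|x| <= e) in
  0 <= e -> inactive_or 0 x0 -> inactive_or 1 x1 -> inactive_or 4 x4 -> inactive_or 5 x5 ->
  `|(x0 + x4) + (x1 + x5)| <= e.
Proof.
move=> P e0 h0 h1 h4 h5.
have excl d d' x x' : d + 1 <= d' -> P d x -> P d' x' -> x = 0 \/ x' = 0.
  move=> dd' [->|[/andP[? ?] _]]; first by left.
  by move=> [->|[/andP[? ?] _]]; [right|lra].
have bnd d x : P d x -> `|x| <= e by move=> [->|[]//]; rewrite normr0.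
have : (`|x0| <= e /\ `|x1| <= e) /\ (`|x4| <= e /\ `|x5| <= e).
  by split; split; [exact: bnd h0|exact: bnd h1|exact: bnd h4|exact: bnd h5].
have h01 := excl _ _ _ _ _ h0 h1; have h04 := excl _ _ _ _ _ h0 h4.
have h05 := excl _ _ _ _ _ h0 h5; have h14 := excl _ _ _ _ _ h1 h4.
have h15 := excl _ _ _ _ _ h1 h5; have h45 := excl _ _ _ _ _ h4 h5.
move=> [[b0 b1] [b4 b5]].
have [x00|/eqP x00] := eqVneq x0 0; last first.
  have [//|->] := h01 ltac:(lra); have [//|->] := h04 ltac:(lra).
  by have [//|->] := h05 ltac:(lra); rewrite !addr0.
have [x10|/eqP x10] := eqVneq x1 0; last first.
  have [//|->] := h14 ltac:(lra); have [//|->] := h15 ltac:(lra).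
  by rewrite x00 !(addr0, add0r).
have [x40|/eqP x40] := eqVneq x4 0; last first.
  have [//|->] := h45 ltac:(lra).
  by rewrite x00 x10 !(addr0, add0r).
by rewrite x00 x10 x40 !(add0r).
Qed.

Section factorisation.
Context {R : realType} {mu4 mu16 lam16 : probability R R}.
Hypothesis ss4 : self_similar 4 1 mu4.
Hypothesis ss16 : self_similar 16 1 mu16.
Hypothesis ssl : self_similar 16 4 lam16.

Let N4 : 4 <= 4 :> R. Proof. by []. Qed.
Let N16 : 4 <= 16 :> R. Proof. by rewrite ler_nat. Qed.

(** Open rays generate the Borel sets and are stable under intersection, so it suffices to compare
    the distribution functions [F] and [G]. *)
Let ray (t : R) : set R := `]-oo, t[%classic.
Let F (t : R) := pr mu4 (ray t).
Let G (t : R) := conv lam16 mu16 (ray t).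

Let measurable_ray t : measurable (ray t). Proof. exact: measurable_itv. Qed.

Let hull_sum (u s : R) : `[0, hull 16 1]%classic u -> `[0, hull 16 4]%classic s ->
  0 <= u + s <= 3^-1.
Proof.
rewrite /= !in_itv/= hull16_1 hull16_4 => /andP[? ?] /andP[? ?].
by apply/andP; split; lra.
Qed.

Let F0 t : t <= 0 -> F t = 0.
Proof.
move=> t0; apply: (pr_full _ _ (self_similar_hull N4 ltr01 ss4)) => //.
by rewrite -subset0 /ray => x [/=]; rewrite !in_itv/= => /andP[? _] ?; lra.
Qed.

Let F1 t : 3^-1 < t -> F t = 1.
Proof.
move=> t1; apply/eqP; rewrite eq_le pr_le1//= -(self_similar_hull N4 ltr01 ss4).
by apply: le_pr => // x; rewrite /ray/= !in_itv/= hull4_1 => /andP[_ ?]; lra.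
Qed.

Let G0 t : t <= 0 -> G t = 0.
Proof.
move=> t0; apply: (conv_eq_const _ _ _ (self_similar_hull N16 (ltr0n _ 4) ssl)) => //.
  by rewrite normr0.
move=> s hs; apply: (pr_full _ _ (self_similar_hull N16 ltr01 ss16)) => //.
  exact: measurable_translate.
rewrite -subset0 => u [hu /=]; rewrite /ray/= in_itv/=.
by have /andP[? _] := hull_sum hu hs; lra.
Qed.

Let G1 t : 3^-1 < t -> G t = 1.
Proof.
move=> t1; apply: (conv_eq_const _ _ _ (self_similar_hull N16 (ltr0n _ 4) ssl)) => //.
  by rewrite normr1.
move=> s hs; apply/eqP; rewrite eq_le pr_le1//=; last exact: measurable_translate.
rewrite -(self_similar_hull N16 ltr01 ss16); apply: le_pr => //.
  exact: measurable_translate.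
move=> u hu; rewrite /ray/= in_itv/=.
by have /andP[_ ?] := hull_sum hu hs; lra.
Qed.

Let ray_preimage (N a t : R) : 0 < N ->
  [set y | ray t (N^-1 * y + N^-1 * a)] = ray (N * t - a).
Proof.
move=> N0; rewrite /ray; apply/seteqP; split => y /=; rewrite !in_itv/= -mulrDr;
  by rewrite ltr_pdivrMl// ltrBrDr.
Qed.

(** Two steps in base 4, giving the same four digits as the recursion of [G]. *)
Let F_step t : 4 * F t = (F (16 * t - 0) + F (16 * t - 4)) + (F (16 * t - 1) + F (16 * t - 5)).
Proof.
have S s : 2 * F s = F (4 * s - 0) + F (4 * s - 1).
  rewrite /F (self_similarE N4 ss4 (measurable_ray s)).
  by rewrite -!(ray_preimage _ _ (ltr0n _ 4)) mulr0.
have := S t; have := S (4 * t - 0); have := S (4 * t - 1).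
rewrite (_ : 4 * (4 * t - 1) - 0 = 16 * t - 4); last by ring.
rewrite (_ : 4 * (4 * t - 1) - 1 = 16 * t - 5); last by ring.
rewrite (_ : 4 * (4 * t - 0) - 0 = 16 * t - 0); last by ring.
rewrite (_ : 4 * (4 * t - 0) - 1 = 16 * t - 1); last by ring.
by lra.
Qed.

Let G_step t : 4 * G t = (G (16 * t - 0) + G (16 * t - 4)) + (G (16 * t - 1) + G (16 * t - 5)).
Proof.
rewrite /G (self_similar_conv ss16 ssl (measurable_ray t)).
by rewrite !(ray_preimage _ _ (ltr0n _ 16)).
Qed.

(** The gap at [t] is a quarter of the sum of the gaps at [16 t - d], of which at most one is
    nonzero; the uniform bound thus shrinks by 4, more than the factor 2 required. *)
Let FG_close n t : `|F t - G t| <= 2^-1 ^+ n.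
Proof.
have FG_out s : s <= 0 \/ 3^-1 < s -> F s = G s.
  by move=> [s0|s1]; [rewrite F0// G0|rewrite F1// G1].
elim: n t => [|n IH] t.
  rewrite expr0; have := pr_ge0 mu4 (ray t); have := pr_le1 mu4 (measurable_ray t).
  have b := bounded_measurable_translate mu16 (measurable_ray t).
  have := normr_Rintegral_le1 lam16 b; rewrite -[X in `|X| <= 1]/(G t) ler_norml => /andP[_ g1].
  have g0 : 0 <= G t by apply: Rintegral_ge0 => s _; exact: pr_ge0.
  by rewrite -[pr mu4 (ray t)]/(F t) ler_norml => ? ?; apply/andP; split; lra.
have := F_step t; have := G_step t.
have D d : F (16 * t - d) - G (16 * t - d) = 0 \/
    (0 < 16 * t - d <= 3^-1) /\ (`|F (16 * t - d) - G (16 * t - d)| <= 2^-1 ^+ n).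
  have [h|h] := leP (16 * t - d) 0; first by left; rewrite FG_out ?subrr//; left.
  have [h'|h'] := ltP 3^-1 (16 * t - d); first by left; rewrite FG_out ?subrr//; right.
  by right; split; last exact: IH.
have e0 : 0 <= 2^-1 ^+ n :> R by rewrite exprn_ge0.
have := at_most_one_digit e0 (D 0) (D 1) (D 4) (D 5).
rewrite !ler_norml exprS => /andP[? ?] hG hF; apply/andP; split; lra.
Qed.

Let FG t : F t = G t.
Proof.
apply/eqP; rewrite -subr_eq0 -normr_le0; apply: (@le0_expr2V _ _ 1) => n.
by rewrite mul1r; exact: FG_close.
Qed.

(** The convolution is realised as the image [tau] of the product measure under addition; uniqueness
    of measures extends the equality from rays to Borel sets. *)
Lemma mu4_conv (E : set R) : measurable E -> pr mu4 E = conv lam16 mu16 E.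
Proof.
move=> mE.
have madd : measurable_fun setT (fun z : R * R => z.2 + z.1).
  by apply: measurable_funD; [exact: measurable_snd|exact: measurable_fst].
pose tau : {measure set R -> \bar R} :=
  measure_function_pushforward__canonical__measure_function_Measure
    (lam16 \x mu16)%E madd.
have tauE A : measurable A -> tau A = (conv lam16 mu16 A)%:E.
  move=> mA; rewrite /conv /Rintegral fineK.
    apply: eq_integral => s _ /=; rewrite -prE; last exact: measurable_translate.
    by rewrite xsectionE.
  apply: integrable_fin_num => //.
  exact/bounded_measurable_integrable/bounded_measurable_translate.
apply: EFin_inj; rewrite -tauE// -prE//.
apply: (measure_unique [set A | exists t, A = ray t] (fun n => ray n%:R)) => //.
- exact: RGenInftyO.measurableE.
- move=> _ _ [t ->] [t' ->]; exists (Num.min t t'); rewrite /ray.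
  by apply/seteqP; split => x /=; rewrite !in_itv/= lt_min; [move=> [-> ->]|move=> /andP[]].
- by move=> n; exists n%:R.
- apply/seteqP; split => // x _; exists (Num.bound `|x|) => //=.
  by rewrite /ray/= in_itv/= (le_lt_trans (ler_norm x))// archi_boundP.
- move=> _ [t ->]; transitivity ((F t)%:E); first exact: prE.
  by rewrite FG; exact/esym/tauE.
- by move=> n; rewrite -ge0_fin_numE//; exact: (fin_num_measure mu4).
Qed.

End factorisation.

(** * Translational singularity *)

Section translational_singularity.
Context {R : realType} {mu4 mu16 lam16 : probability R R} {a : R}.
Hypothesis ss4 : self_similar 4 1 mu4.
Hypothesis ss16 : self_similar 16 1 mu16.
Hypothesis ssl : self_similar 16 4 lam16.

Let N16 : 4 <= 16 :> R. Proof. by rewrite ler_nat. Qed.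

Let K : set R := cantor 16 1.
Let mK : measurable K. Proof. exact: measurable_cantor. Qed.

Let L : set R := cantor 16 4.
Let mL : measurable L. Proof. exact: measurable_cantor. Qed.

(* By the packing property [b - K] meets [L] in at most one point. *)
Let lam16_reflect (b : R) : lam16 [set s | K (b + (a + -1 * s))] = 0%E.
Proof.
have mB : measurable [set s | K (b + (a + -1 * s))].
  by have := measurable_preaffine (-1) (b + a) mK; congr measurable;
    apply/seteqP; split => s /=; rewrite [_ + (b + a)]addrC addrA.
apply: pr_eq0 => //.
rewrite -(pr_setI mB mL (pr_cantor N16 (ltr0n _ 4) ssl)).
have [[s [Ks Ls]]|h] := pselect (exists s, ([set s | K (b + (a + -1 * s))] `&` L) s).
  apply/eqP; rewrite eq_le pr_ge0 andbT.
  rewrite -(self_similar_set1 N16 (ltr0n _ 4) ssl s); apply: le_pr => //.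
    exact: measurableI.
  move=> s' [Ks' Ls'] /=; rewrite /= in Ks Ks'.
  have := packing_cantor Ks Ks' Ls' Ls.
  by move=> /(_ ltac:(ring)); lra.
rewrite (_ : _ `&` _ = set0) ?/pr ?measure0//.
by rewrite -subset0 => s Hs; apply: h; exists s.
Qed.

(** The shifts [s] for which [K + s - a] is [mu16]-null. *)
Let generic_shift : set R := [set s | pr mu16 [set y | K (y + (a + -1 * s))] = 0].

Let bm_shift : bounded_measurable (fun s => pr mu16 [set y | K (y + (a + -1 * s))]).
Proof.
have := bounded_measurable_affine (-1) a (bounded_measurable_translate mu16 mK).
by congr bounded_measurable; apply/funext => s; rewrite [-1 * s + a]addrC.
Qed.

Let measurable_generic : measurable generic_shift.
Proof.
rewrite -[generic_shift]setTI; have := bm_shift.1 measurableT [set 0].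
by apply; exact: measurable_set1.
Qed.

(** By Tonelli the integral over [s] of [mu16 (K + s - a)] equals an integral of the masses in
    [lam16_reflect], hence is 0; a nonnegative function with zero integral vanishes almost
    everywhere. *)
Let pr_generic : pr lam16 generic_shift = 1.
Proof.
have mf : measurable_fun setT (fun s : R => (pr mu16 [set y | K (y + (a + -1 * s))])%:E).
  by apply/measurable_EFinP; exact: bm_shift.1.
have I0 : (\int[lam16]_s `|(pr mu16 [set y | K (y + (a + -1 * s))%R])%:E| = 0)%E.
  transitivity (\int[lam16]_s mu16 [set y | K (y + (a + -1 * s))%R])%E.
    apply: eq_integral => s _; rewrite gee0_abs ?lee_fin ?pr_ge0//.
    by rewrite -prE//; exact: measurable_translate.
  rewrite fubini_translate//; apply: integral0_eq => u _; exact: lam16_reflect.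
have [Z [mZ Z0 sub]] := (ae_eq_integral_abs lam16 measurableT mf).1 I0.
suff : pr lam16 (~` generic_shift) = 0 by rewrite prC//; lra.
apply/eqP; rewrite eq_le pr_ge0 andbT.
have -> : 0 = pr lam16 Z by rewrite /pr Z0.
apply: le_pr => //; first exact: measurableC.
by move=> s gs; apply: sub => /= h; apply: gs; exact: EFin_inj (h Logic.I).
Qed.

Lemma mixture_singular :
  translationally_singular (sum_measure mu4 (translate_measure a mu16)).
Proof.
move=> [X [[mX _ rhoXK] tac]].
pose rho : {finite_measure set R -> \bar R} := sum_measure mu4 (translate_measure a mu16).
have rhoX : rho X = rho setT by exact: etrans rhoXK (closed_support_full rho).
have rhoE (A : set R) : rho A = (mu4 A + mu16 [set y | A (y + a)%R])%E by exact: measure_addE.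
have mt (A : set R) b : measurable A -> measurable [set y | A (y + b)].
  exact: measurable_translate.
have rho_pr (A : set R) : measurable A -> rho A = (pr mu4 A + pr mu16 [set y | A (y + a)])%:E.
  by move=> mA; rewrite rhoE (prE mu4)// (prE mu16)//; exact: mt.
(* The two masses are at most 1 and add up to 2. *)
have [X4 X16] : pr mu4 X = 1 /\ pr mu16 [set y | X (y + a)] = 1.
  have := rhoX; rewrite !rho_pr// => -[].
  have -> : [set y : R | setT (y + a)] = setT by [].
  rewrite !prT; have := pr_le1 mu4 mX; have := pr_le1 mu16 (mt _ a mX).
  by move=> ? ? ?; split; lra.
have rhoX0 : (0 < rho X)%E by rewrite rho_pr// X4 X16 lte_fin; lra.
(* Absolute continuity is applied to [E = X] itself. *)
have {}tac := tac X mX (fun _ => id) rhoX0.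
have main s : generic_shift s -> pr mu16 [set y | X (y + s)] = 0.
  move=> gs; pose F := [set z | [/\ K (z - s), X (z - s + a) & X z]].
  have mF : measurable F.
    have := measurableI _ _ (mt _ (- s) mK) (measurableI _ _ (mt _ (- s + a) mX) mX).
    by congr measurable; apply/seteqP; split => z /=; rewrite addrA;
      [move=> [? []]|move=> []].
  (* The set [F] lies in [K + s], which is [mu4]-null as a translate of [K] and null for the
     translated [mu16] because [s] is generic. *)
  have F0 : rho F = 0%E.
    rewrite rho_pr// (_ : pr mu4 F = 0) 1?(_ : pr mu16 _ = 0) ?addr0//.
    - apply/eqP; rewrite eq_le pr_ge0 andbT -gs; apply: le_pr; first exact: mt.
        exact: mt.
      by move=> y [+ _ _] /=; rewrite mulN1r addrA.
    - apply/eqP; rewrite eq_le pr_ge0 andbT -(pr_cantor_translate ss4 (- s)).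
      by apply: le_pr => //; [exact: mt|move=> z []].
  (* The translation by [a - s] carries [K + s] onto [a + K], where the translate of [mu16]
     lives. *)
  have /null_content_dominatesP/(_ F mF F0) := tac (a - s).
  have E : [set y + (a - s) | y in F] `&` [set y + (a - s) | y in X] =
      [set w | [/\ K (w - a), X w & X (w + (s - a))]].
    apply/seteqP; split => [_ [[z [Kz Xz Xz'] <-] _]|w [Kw Xw Xw']] /=.
      have e1 : z + (a - s) - a = z - s by ring.
      have e2 : z + (a - s) = z - s + a by ring.
      have e3 : z - s + a + (s - a) = z by ring.
      by split; rewrite ?e1// e2 ?e3.
    have e1 : w + (s - a) - s = w - a by ring.
    have e2 : w - a + a = w by ring.
    have e3 : w + (s - a) + (a - s) = w by ring.
    by split; exists (w + (s - a)) => //; split => //; rewrite e1 ?e2.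
  rewrite E rho_pr; last first.
    have := measurableI _ _ (mt _ (- a) mK) (measurableI _ _ mX (mt _ (s - a) mX)).
    by congr measurable; apply/seteqP; split => z /=;
      [move=> [? []]|move=> []].
  move=> -[h].
  have {}h : pr mu16 [set y | [/\ K (y + a - a), X (y + a) & X (y + a + (s - a))]] = 0.
    by move: h; have := pr_ge0 mu4; have := pr_ge0 mu16 => g1 g2;
      rewrite /= => h; apply/eqP; rewrite eq_le pr_ge0 andbT -h lerDr.
  (* Both [K] and [X - a] have full [mu16]-mass, so cutting [X - s] by them changes nothing and
     yields the null set of [h]. *)
  rewrite -(pr_setI (mt _ s mX) mK (pr_cantor N16 ltr01 ss16)).
  rewrite -(pr_setI _ (mt _ a mX) X16); last exact: measurableI (mt _ s mX) mK.
  have e y : y + a + (s - a) = y + s by ring.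
  rewrite -h; congr pr; apply/seteqP; split => y /=.
    by move=> [[? ?] ?]; rewrite addrK e.
  by rewrite addrK e => -[].
(* By the factorisation, [mu4 X] is the [lam16]-average of [mu16 (X - s)], which vanishes for
   generic [s]. *)
have : pr mu4 X = 0.
  rewrite (mu4_conv ss4 ss16 ssl mX).
  apply: (conv_eq_const mX _ measurable_generic pr_generic); last exact: main.
  by rewrite normr0.
by rewrite X4; lra.
Qed.

End translational_singularity.

Theorem proposition3p5 (R : realType) (mu4 mu16 lam16 : probability R R)
    (hmu4 : self_similar 4 1 mu4)
    (hmu16 : self_similar 16 1 mu16)
    (hlam16 : self_similar 16 4 lam16) :
  packing_pair (closed_support mu16) (closed_support lam16) /\
  forall x : R,
    translationally_singular (sum_measure mu4 (translate_measure x mu16)) /\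
    ~ (exists Gamma : {measure set R -> \bar R},
         frame_measure (sum_measure mu4 (translate_measure x mu16)) Gamma).
Proof.
split; first exact: packing_pair_support.
move=> x; split; first exact: (mixture_singular hmu4 hmu16 hlam16).
by move=> [Gamma]; exact: no_frame_measure.
Qed.
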